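(* Let $K\subset\mathbb{C}$ be a compact set such that $\mathbb{C}\setminus K$ is connected. Then $SB(A(K))=\partial K$.
   Context: $A(K)$ is the uniform algebra (with the sup norm $\|\cdot\|$ on $K$) of all complex-valued functions continuous on $K$ and holomorphic on $\mathrm{int}(K)$; $\partial K$ is the topological boundary of $K$ in $\mathbb{C}$. A point $z\in K$ is a strong boundary point for $A(K)$ if for every open neighborhood $U_z$ of $z$ there exists $f\in A(K)$ such that $\|f\|=f(z)=1$ and $|f(w)|<1$ for every $w\in K\setminus U_z$. $SB(A(K))$ is the set of strong boundary points for $A(K)$. *)

(* Defs.v *)
From HB Require Import structures.
From mathcomp Require Import all_boot all_order all_algebra.
From mathcomp Require Import all_classical all_reals all_analysis.
From mathcomp Require Export complex.

Set Implicit Arguments.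
Unset Strict Implicit.
Unset Printing Implicit Defensive.
Import Order.TTheory GRing.Theory Num.Theory.
Import numFieldNormedType.Exports.

Local Open Scope classical_set_scope.
Local Open Scope ring_scope.

(* The regular alias carries the topology given by the modulus and makes the
   plane a normed module over [R[i]]; hence [derivable f z 1] below is complex
   differentiability at [z]. *)
Notation Cplane R := (R[i]^o).

Definition boundary (T : topologicalType) (A : set T) : set T :=
  closure A `\` interior A.

(* A function on [K] is represented by any function on the whole plane; only
   its values on [K] matter in the definitions below. *)
Definition uniform_algebra (R : realType) (K : set (Cplane R)) :
    set (Cplane R -> Cplane R) :=
  [set f | {within K, continuous f} /\
           forall z, interior K z -> derivable f z 1].

(* The modulus [`|x|] of [x : R[i]] is again in [R[i]], with zero imaginary
   part. *)
Definition sup_norm (R : realType) (K : set (Cplane R))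
    (f : Cplane R -> Cplane R) : R :=
  sup [set complex.Re `|f w| | w in K].

Definition strong_boundary (R : realType) (K : set (Cplane R)) :
    set (Cplane R) :=
  [set z | K z /\
    forall U : set (Cplane R), open U -> U z ->
      exists f, [/\ uniform_algebra K f, sup_norm K f = 1,
        f z = 1 & forall w, (K `\` U) w -> `|f w| < 1]].

(* Main.v *)
Require Import Defs.
From mathcomp Require Import all_boot all_order all_algebra.
From mathcomp Require Import all_classical all_reals all_analysis.
From mathcomp Require Import ring lra.
Set Implicit Arguments.
Unset Strict Implicit.
Unset Printing Implicit Defensive.
Import Order.TTheory GRing.Theory Num.Theory.
Import numFieldNormedType.Exports.
Local Open Scope classical_set_scope.
Local Open Scope ring_scope.

(** Interior points are excluded by the maximum principle: writing a circle as
    [z + r * expR s * e^(it)], a bisection argument in the [(s, t)]-plane (no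
    continuity of the derivative is needed) shows that the mean of [Re f] over
    it does not depend on [s], hence equals [Re (f z) = 1]; but [Re f < 1] on
    one of the circles.

    For a boundary point [c], take [p] outside [K] extremely close to [c]. As
    the complement of [K] is connected and unbounded, inside the disc of radius
    [d] around [c] one can move [p] within the complement to some [q] at distance
    at least [d / 2] from [c], and continue along the way a branch [S] on [K] of
    the square root of [(w - p) / (w - q)]. Then [(1 - S) / (1 + S)] is bounded
    on [K] by an absolute constant, is bounded below at [c], and is small away
    from [c]. Normalised at [c], such functions for ever smaller discs combine
    into a convergent series that peaks exactly at [c]. *)

(** * The modulus of complex numbers as a real-valued function *)

Section Modulus.
Variable R : realType.
Implicit Types x y z w : R[i].

(** The norm on [R[i]] takes values in [R[i]] itself; its real part lives in the ordered field [R],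
    where linear arithmetic settles estimates. *)
Definition cmod z : R := complex.Re `|z|.

Lemma cmodE z : `|z| = (cmod z)%:C%C.
Proof. by rewrite /cmod normc_def. Qed.

Lemma cmod_ge0 z : 0 <= cmod z.
Proof. by rewrite -lecR -cmodE normr_ge0. Qed.

Lemma cmodM x y : cmod (x * y) = cmod x * cmod y.
Proof. by apply: (@complexI R); rewrite rmorphM/= -!cmodE normrM. Qed.

Lemma cmodV x : cmod x^-1 = (cmod x)^-1.
Proof. by apply: (@complexI R); rewrite fmorphV/= -!cmodE normfV. Qed.

Lemma cmodN x : cmod (- x) = cmod x.
Proof. by rewrite /cmod normrN. Qed.

Lemma cmodBC x y : cmod (x - y) = cmod (y - x).
Proof. by rewrite -cmodN opprB. Qed.

Lemma cmodD x y : cmod (x + y) <= cmod x + cmod y.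
Proof. by rewrite -lecR rmorphD/= -!cmodE ler_normD. Qed.

Lemma cmod_le_add x y : cmod x <= cmod y + cmod (x - y).
Proof. by rewrite -{1}(subrK y x) addrC cmodD. Qed.

Lemma cmod_dist x y z : cmod (x - z) <= cmod (x - y) + cmod (y - z).
Proof. by rewrite -{1}(subrK y x) -addrA cmodD. Qed.

Lemma cmod_eq0 x : (cmod x == 0) = (x == 0).
Proof. by rewrite -(inj_eq (@complexI R)) -cmodE normr_eq0. Qed.

Lemma cmod_gt0 x : (0 < cmod x) = (x != 0).
Proof. by rewrite lt_neqAle cmod_ge0 andbT eq_sym cmod_eq0. Qed.

Lemma cmod0 : cmod 0 = 0.
Proof. by apply/eqP; rewrite cmod_eq0. Qed.

Lemma cmodR (a : R) : cmod a%:C%C = `|a|.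
Proof.
by rewrite /cmod normc_def /= expr0n /= addr0 sqrtr_sqr.
Qed.

Lemma cmod1 : cmod 1 = 1.
Proof. by rewrite /cmod normr1. Qed.

Lemma cmod_nat (n : nat) : cmod n%:R = n%:R.
Proof. by apply: (@complexI R); rewrite -cmodE normr_nat rmorph_nat. Qed.

Lemma cmod_Re z : `|complex.Re z| <= cmod z.
Proof. by rewrite -lecR -cmodE normc_ge_Re. Qed.

Lemma cmod_Im z : `|complex.Im z| <= cmod z.
Proof.
rewrite /cmod normc_def /= -sqrtr_sqr ler_sqrt ?sqr_ge0//.
  by rewrite lerDr sqr_ge0.
by rewrite addr_ge0 ?sqr_ge0.
Qed.

Lemma cmod_le_ReIm z : cmod z <= `|complex.Re z| + `|complex.Im z|.
Proof.
have -> : z = ((complex.Re z)%:C + 'i * (complex.Im z)%:C)%C by case: z => a b; simpc.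
apply: (le_trans (cmodD _ _)); rewrite cmodM !cmodR /=; simpc.
rewrite /= ?(mul0r, mulr0, addr0, subr0, add0r, mul1r) /cmod normc_def /=.
by rewrite expr0n /= expr1n add0r sqrtr1 mul1r.
Qed.

End Modulus.

(** * Topology and differentiability of the plane in epsilon-delta form *)

Section Topology.
Variable R : realType.
Local Notation C := (Cplane R).

Lemma cplane_nbhsP (z : C) (U : set C) :
  nbhs z U <-> exists2 e : R, 0 < e & forall w : C, cmod (w - z) < e -> U w.
Proof.
split.
  move/nbhs_ballP => [e /= e0 eU].
  (* Radii of balls are elements of [R[i]]; a positive one is real. *)
  have eR : e = (complex.Re e)%:C%C.
    by rewrite RRe_real// ger0_real// ltW.
  exists (complex.Re e); first by rewrite -ltcR -eR.
  move=> w wz; apply: eU; rewrite /ball/= /ball_ /=.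
  by rewrite distrC cmodE eR ltcR.
move=> [e e0 eU]; apply/nbhs_ballP; exists (e%:C%C); first by rewrite /= ltcR.
move=> w; rewrite /ball/= /ball_ /= distrC cmodE ltcR; exact: eU.
Qed.

Lemma cplane_continuousP (K : set C) (f : C -> C) :
  {within K, continuous f} <->
  forall z, K z -> forall e : R, 0 < e -> exists2 d : R, 0 < d &
    forall w, K w -> cmod (w - z) < d -> cmod (f w - f z) < e.
Proof.
split=> [/subspace_continuousP cf z Kz e e0|cf].
  have /cf : K z by [].
  have fU : nbhs (f z) [set y : C | cmod (y - f z) < e].
    by apply/cplane_nbhsP; exists e.
  move=> /(_ _ fU) /cplane_nbhsP [d d0 dU].
  by exists d => // w Kw /dU; exact.
apply/subspace_continuousP => z Kz U /cplane_nbhsP [e e0 eU].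
have [d d0 dU] := cf z Kz e e0.
by apply/cplane_nbhsP; exists d => // w wz Kw; apply: eU; exact: dU.
Qed.

Lemma cplane_derivableP (f : C -> C) (z : C) :
  derivable f z 1 <->
  exists l : C, forall e : R, 0 < e -> exists2 d : R, 0 < d &
    forall w : C, cmod (w - z) < d ->
      cmod (f w - f z - l * (w - z)) <= e * cmod (w - z).
Proof.
split=> [/cvg_ex [l fl]|[l fl]].
  exists l => e e0.
  have lU : nbhs l [set y : C | cmod (y - l) < e].
    by apply/cplane_nbhsP; exists e.
  have /cplane_nbhsP [d d0 dU] := fl _ lU.
  exists d => // w wz; have [->|wzN] := eqVneq w z.
    by rewrite !subrr mulr0 subrr cmod0 mulr0.
  have wz0 : w - z != 0 by rewrite subr_eq0.
  have := dU (w - z); rewrite subr0 => /(_ wz wz0) /=.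
  rewrite /GRing.scale /= mulr1 subrK => /ltW h.
  have -> : f w - f z - l * (w - z) = ((w - z)^-1 * (f w - f z) - l) * (w - z).
    by rewrite mulrBl mulrAC mulVf// mul1r.
  by rewrite cmodM ler_wpM2r ?cmod_ge0.
apply/cvg_ex; exists l => U /cplane_nbhsP [e e0 eU].
have [d d0 dU] := fl (e / 2) (divr_gt0 e0 (ltr0Sn _ 1)).
apply/cplane_nbhsP; exists d => // h; rewrite subr0 => hd h0.
apply: eU; have := dU (h + z); rewrite addrK => /(_ hd).
rewrite /GRing.scale /= mulr1 => H.
have -> : h^-1 * (f (h + z) - f z) - l = h^-1 * (f (h + z) - f z - l * h).
  by rewrite [RHS]mulrBr; congr (_ - _); rewrite mulrCA mulVf// mulr1.
have h0' : 0 < cmod h by rewrite cmod_gt0.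
rewrite cmodM cmodV mulrC ltr_pdivrMr//.
by apply: (le_lt_trans H); rewrite ltr_pM2r// ltr_pdivrMr// ltr_pMr// ltr1n.
Qed.

Lemma cplane_derivable_continuous (f : C -> C) (z : C) : derivable f z 1 ->
  forall e : R, 0 < e -> exists2 d : R, 0 < d &
    forall w : C, cmod (w - z) < d -> cmod (f w - f z) < e.
Proof.
move=> /derivable1_diffP /differentiable_continuous cf e e0.
have fU : nbhs (f z) [set y : C | cmod (y - f z) < e].
  by apply/cplane_nbhsP; exists e.
by have /cplane_nbhsP := cf _ fU.
Qed.

Lemma cplane_closureP (A : set C) (z : C) :
  closure A z <-> forall e : R, 0 < e -> exists2 w, A w & cmod (w - z) < e.
Proof.
split=> [cA e e0|H U /cplane_nbhsP [e e0 eU]].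
  have [|w [Aw wz]] := cA [set w | cmod (w - z) < e].
    by apply/cplane_nbhsP; exists e.
  by exists w.
by have [w Aw wz] := H e e0; exists w; split => //; exact: eU.
Qed.

Lemma cplane_interiorP (A : set C) (z : C) :
  interior A z <-> exists2 e : R, 0 < e & forall w, cmod (w - z) < e -> A w.
Proof. exact: cplane_nbhsP. Qed.

Lemma cplane_open_ball (z : C) (r : R) : open [set w : C | cmod (w - z) < r].
Proof.
rewrite openE => w /= wz; apply/cplane_interiorP.
exists (r - cmod (w - z)); first by rewrite subr_gt0.
move=> y yw; apply: (le_lt_trans (cmod_dist _ w _)); lra.
Qed.

Lemma cplane_compact_closed (K : set C) : compact K -> closed K.
Proof. apply: compact_closed; exact: norm_hausdorff. Qed.

Lemma cplane_compact_bounded (K : set C) (c : C) : compact K ->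
  exists M : R, forall w, K w -> cmod (w - c) <= M.
Proof.
move=> cK.
have cd : continuous (fun w : C => cmod (w - c) : R^o).
  move=> w U /nbhs_ballP [e /= e0 eU].
  apply/cplane_nbhsP; exists e => // y yw; apply: eU.
  rewrite /ball /= ltr_distl; apply/andP; split.
    have := cmod_dist y w c; lra.
  have := cmod_dist w y c; rewrite (cmodBC w y); lra.
have /compact_bounded [M [_ MK]] :=
  continuous_compact (continuous_subspaceT cd) cK.
exists (M + 1) => w Kw; have M1 : M < M + 1 by rewrite ltrDl.
have : [set cmod (y - c) | y in K] (cmod (w - c)) by exists w.
by move/(MK _ M1); rewrite /= ger0_norm ?cmod_ge0.
Qed.

(* The supremum of the lower bounds [a m - e m] works, because each of them
   is below every upper bound [a n + e n]. *)
Lemma real_cauchy_lim (a e : nat -> R) :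
  (forall m n, (m <= n)%N -> `|a n - a m| <= e m) ->
  exists l, forall m, `|l - a m| <= e m.
Proof.
move=> ae.
have lu m n : a m - e m <= a n + e n.
  have em := ae _ _ (leqnn m); have en := ae _ _ (leqnn n).
  move: em en; rewrite !subrr !normr0 => em en.
  case/orP: (leq_total m n) => /ae; rewrite ler_distl => /andP[]; lra.
pose A := [set a m - e m | m in [set: nat]].
have A0 : A !=set0 by exists (a 0%N - e 0%N), 0%N.
exists (sup A) => m; rewrite ler_distl; apply/andP; split.
  apply: ub_le_sup; last by exists m.
  by exists (a 0%N + e 0%N) => _ [n _ <-].
by apply: ge_sup => // _ [n _ <-].
Qed.

(* The factor 2 comes from taking real and imaginary limits separately. *)
Lemma cplane_cauchy_lim (a : nat -> R[i]) (e : nat -> R) :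
  (forall m n, (m <= n)%N -> cmod (a n - a m) <= e m) ->
  exists l, forall m, cmod (l - a m) <= 2 * e m.
Proof.
move=> ae.
have [|x xa] := @real_cauchy_lim (fun n => complex.Re (a n)) e.
  by move=> m n /ae; apply: le_trans; rewrite -raddfB cmod_Re.
have [|y ya] := @real_cauchy_lim (fun n => complex.Im (a n)) e.
  by move=> m n /ae; apply: le_trans; rewrite -raddfB cmod_Im.
exists (x +i* y)%C => m; apply: (le_trans (cmod_le_ReIm _)).
have := xa m; have := ya m; case: (a m) => u v /=; simpc => /=; lra.
Qed.

End Topology.

(** * Goursat's bisection argument on rectangles *)

Section Goursat.
Variable R : realType.

(* If [H = U - V] with [U] a [t]-primitive of [u] and [V] an [s]-primitive of
   [v], this is the integral of [v ds + u dt] around the rectangle with corner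
   [(s, t)] and sides [w] and [k]. *)
Definition mixed_diff (H : R -> R -> R) (s t w k : R) : R :=
  H (s + w) (t + k) - H (s + w) t - H s (t + k) + H s t.

Lemma half_exp (x : R) n : x / 2 ^+ n.+1 + x / 2 ^+ n.+1 = x / 2 ^+ n.
Proof. by rewrite exprS invfM; field. Qed.

Lemma mixed_diff_split H s t w k : mixed_diff H s t (w + w) (k + k) =
  mixed_diff H s t w k + mixed_diff H (s + w) t w k +
  mixed_diff H s (t + k) w k + mixed_diff H (s + w) (t + k) w k.
Proof. by rewrite /mixed_diff !addrA; ring. Qed.

(** The mixed difference is additive over the four quarters, so they cannot all fall below
    [m / 4]. *)
Lemma mixed_diff_quarter H s t w k (m : R) :
  m <= `|mixed_diff H s t (w + w) (k + k)| ->
  exists s' t', [/\ s' = s \/ s' = s + w, t' = t \/ t' = t + k &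
    m / 4 <= `|mixed_diff H s' t' w k|].
Proof.
rewrite mixed_diff_split => mH.
have [h1|h1] := lerP (m / 4) `|mixed_diff H s t w k|.
  by exists s, t; split => //; left.
have [h2|h2] := lerP (m / 4) `|mixed_diff H (s + w) t w k|.
  by exists (s + w), t; split => //; [right|left].
have [h3|h3] := lerP (m / 4) `|mixed_diff H s (t + k) w k|.
  by exists s, (t + k); split => //; [left|right].
exists (s + w), (t + k); split; [by right|by right|].
move: mH.
set a := mixed_diff _ _ _ _ _ in h1 *; set b := mixed_diff _ _ _ _ _ in h2 *.
set c := mixed_diff _ _ _ _ _ in h3 *; set d := mixed_diff _ _ _ _ _ => mH.
have := ler_normD (a + b + c) d; have := ler_normD (a + b) c.
have := ler_normD a b; lra.
Qed.

(** A nonzero value [m] would leave nested rectangles, halved at each stage, with mixed difference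
    at least [m / 4 ^+ n], whereas around their common point it is of smaller order than the squared
    size. *)
Lemma mixed_diff_eq0 (H : R -> R -> R) (s0 t0 W T : R) : 0 < W -> 0 < T ->
  (forall x y, `|x - s0| <= W -> `|y - t0| <= T ->
    forall e : R, 0 < e -> exists2 d : R, 0 < d & forall s t w k : R,
      0 < w < d -> 0 < k < d -> `|x - s| <= w -> `|y - t| <= k ->
      `|mixed_diff H s t w k| <= e * (w + k) ^+ 2) ->
  mixed_diff H s0 t0 W T = 0.
Proof.
move=> W0 T0 loc; apply/eqP; apply: contraT; rewrite -normr_gt0.
set m := `|_| => m0.
pose w n := W / 2 ^+ n; pose k n := T / 2 ^+ n.
have w0 n : 0 < w n by rewrite divr_gt0 ?exprn_gt0.
have k0 n : 0 < k n by rewrite divr_gt0 ?exprn_gt0.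
pose good (p : nat * (R * R)) :=
  m / 4 ^+ p.1 <= `|mixed_diff H p.2.1 p.2.2 (w p.1) (k p.1)|.
pose next (p q : {p | good p}) :=
  [/\ (sval q).1 = (sval p).1.+1,
   (sval p).2.1 <= (sval q).2.1 <= (sval p).2.1 + w (sval p).1.+1 &
   (sval p).2.2 <= (sval q).2.2 <= (sval p).2.2 + k (sval p).1.+1].
have g0 : good (0%N, (s0, t0)).
  by rewrite /good /w /k /= !expr0 !divr1.
have [|z [z0 zS]] := @dependent_choice _ next _ (exist good _ g0).
  move=> [[n [s t]] gn]; apply: cid; have gn2 := gn; move: gn2.
  rewrite /good /w /k /= -(half_exp W) -(half_exp T).
  case/mixed_diff_quarter => s' [t' [hs ht mst]].
  have g' : good (n.+1, (s', t')).
    by rewrite /good /= exprSr invfM mulrA.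
  exists (exist good _ g'); split => //=.
    by have := w0 n.+1; case: hs => ->; rewrite /w; lra.
  by have := k0 n.+1; case: ht => ->; rewrite /k; lra.
have z1 n : (sval (z n)).1 = n.
  by elim: n => [|n IH]; [rewrite z0|case: (zS n) => -> _ _; rewrite IH].
pose s n := (sval (z n)).2.1; pose t n := (sval (z n)).2.2.
have zP n : m / 4 ^+ n <= `|mixed_diff H (s n) (t n) (w n) (k n)|.
  by have := svalP (z n); rewrite /good z1.
have sS n : s n <= s n.+1 <= s n + w n.+1.
  by case: (zS n); rewrite !z1.
have tS n : t n <= t n.+1 <= t n + k n.+1.
  by case: (zS n); rewrite !z1.
(* Nesting: the interval of length [w j] from [s j] lies inside that of length [w i] from [s i]. *)
have sC i j : (i <= j)%N -> s i <= s j <= s i + w i - w j.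
  elim: j => [|j IH]; first by rewrite leqn0 => /eqP ->; lra.
  rewrite leq_eqVlt => /predU1P[<-|]; first by lra.
  by rewrite ltnS => /IH; have := sS j; have := half_exp W j; rewrite -/(w _) -/(w _); lra.
have tC i j : (i <= j)%N -> t i <= t j <= t i + k i - k j.
  elim: j => [|j IH]; first by rewrite leqn0 => /eqP ->; lra.
  rewrite leq_eqVlt => /predU1P[<-|]; first by lra.
  by rewrite ltnS => /IH; have := tS j; have := half_exp T j; rewrite -/(k _) -/(k _); lra.
have [|x xs] := @real_cauchy_lim R s w.
  by move=> i j /sC; have := w0 j; rewrite ler_norml; lra.
have [|y yt] := @real_cauchy_lim R t k.
  by move=> i j /tC; have := k0 j; rewrite ler_norml; lra.
have xs0 : `|x - s0| <= W by have := xs 0%N; rewrite /s /w z0 /= expr0 divr1.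
have yt0 : `|y - t0| <= T by have := yt 0%N; rewrite /t /k z0 /= expr0 divr1.
have WT : 0 < (W + T) ^+ 2 by rewrite exprn_gt0// addr_gt0.
(* With this tolerance the local bound on the [n]-th rectangle is half of the lower bound [zP n]. *)
have e0 : 0 < m / (2 * (W + T) ^+ 2) by rewrite divr_gt0// mulr_gt0.
have [d d0 dP] := loc x y xs0 yt0 _ e0.
have [n nd] : exists n, W / 2 ^+ n < d /\ T / 2 ^+ n < d.
  have [n nP] : exists n, (W + T) / d < 2 ^+ n.
    by exists (Num.bound ((W + T) / d)); exact: upper_nthrootP.
  exists n; rewrite !ltr_pdivrMr ?exprn_gt0//.
  by move: nP; rewrite ltr_pdivrMr// (mulrC _ d); lra.
have := dP (s n) (t n) (w n) (k n); rewrite w0 k0 => /(_ nd.1 nd.2 (xs n) (yt n)).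
apply: contraTT => _; rewrite -ltNge; apply: lt_le_trans (zP n).
have -> : (w n + k n) ^+ 2 = (W + T) ^+ 2 / 4 ^+ n.
  rewrite /w /k -mulrDl exprMn exprVn -exprM mulnC exprM.
  by congr (_ / _ ^+ _); ring.
rewrite mulrA ltr_pM2r ?invr_gt0 ?exprn_gt0//.
rewrite invfM -!mulrA mulVf ?gt_eqF//; lra.
Qed.

Lemma continuous_primitive (g : R -> R) (a : R) : continuous g ->
  exists G : R -> R, forall x, a < x -> is_derive x 1 G (g x).
Proof.
move=> cg; exists (fun x => \int[lebesgue_measure]_(t in `[a, x]) g t)%R => x ax.
have xu : x < x + 1 by rewrite ltrDl.
have gi : (lebesgue_measure).-integrable `[a, x + 1] (EFin \o g).
  apply: continuous_compact_integrable; first exact: segment_compact.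
  exact: continuous_subspaceT.
have [dF Fx] := continuous_FTC1_closed xu gi ax (cg x).
by apply: DeriveDef; [exact: dF|rewrite -derive1E; exact: Fx].
Qed.

(** Subtracting a primitive of the affine function from [G] leaves a derivative bounded by [e], to
    which the mean value theorem applies. *)
Lemma primitive_affine (G g : R -> R) (x y a b e : R) : x <= y ->
  (forall u, x <= u <= y -> is_derive u 1 G (g u)) ->
  (forall u, x <= u <= y -> `|g u - (a + b * u)| <= e) ->
  `|G y - G x - (a * (y - x) + b * (y ^+ 2 - x ^+ 2) / 2)| <= e * (y - x).
Proof.
move=> xy dG ge.
pose P u := G u - (a * u + b * u ^+ 2 / 2).
have dP u : x <= u <= y -> is_derive u 1 P (g u - (a + b * u)).
  move=> /dG dGu; rewrite /P.
  by apply: is_derive_eq; rewrite /GRing.scale /=; lra.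
have [||c] := @MVT_segment R P (fun u => g u - (a + b * u)) x y xy.
- by move=> u; rewrite in_itv /= => /andP[ux uy]; apply: dP; rewrite !ltW.
- apply: derivable_within_continuous => u; rewrite in_itv /= => uxy.
  by have h := dP u uxy; exact: ex_derive.
rewrite in_itv /= => cxy Pyx.
have -> : G y - G x - (a * (y - x) + b * (y ^+ 2 - x ^+ 2) / 2) = P y - P x.
  by rewrite /P; field.
rewrite Pyx normrM (ger0_norm (x := y - x)) ?subr_ge0//.
by apply: ler_wpM2r; [rewrite subr_ge0|exact: ge].
Qed.

End Goursat.

(** * Cauchy-Riemann equations in logarithmic polar coordinates *)

Section Polar.
Variable R : realType.

(** Complex differentiability of [u + i v] at [x + i y] with derivative [a + i b], as one joint
    first-order expansion rather than through partial derivatives. *)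
Definition cauchy_riemann_at (u v : R -> R -> R) (x y : R) :=
  exists a b : R, forall e : R, 0 < e -> exists2 d : R, 0 < d &
    forall s t, `|s - x| < d -> `|t - y| < d ->
      `|u s t - (u x y + a * (s - x) - b * (t - y))| <= e * (`|s - x| + `|t - y|) /\
      `|v s t - (v x y + b * (s - x) + a * (t - y))| <= e * (`|s - x| + `|t - y|).

(** The affine parts of [u] and [v] integrate to zero around the rectangle, because the slope [a] of
    [u] in [s] is also the slope of [v] in [t]. Only the first-order error times the side lengths
    remains. *)
Lemma cauchy_riemann_mixed_diff (u v U V : R -> R -> R) (x y d0 : R) : 0 < d0 ->
  cauchy_riemann_at u v x y ->
  (forall s t, `|s - x| < d0 -> `|t - y| < d0 -> is_derive t 1 (U s) (u s t)) ->
  (forall s t, `|s - x| < d0 -> `|t - y| < d0 ->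
     is_derive s 1 (fun s' => V s' t) (v s t)) ->
  forall e : R, 0 < e -> exists2 d : R, 0 < d & forall s t w k : R,
    0 < w < d -> 0 < k < d -> `|x - s| <= w -> `|y - t| <= k ->
    `|mixed_diff (fun s t => U s t - V s t) s t w k| <= e * (w + k) ^+ 2.
Proof.
move=> d00 [a [b cr]] dU dV e e0.
have [d d_gt0 dP] := cr _ (divr_gt0 e0 (ltr0Sn _ 7)).
exists (Num.min d d0 / 2).
  by rewrite divr_gt0// lt_min d_gt0.
move=> s t w k; rewrite !ltr_pdivlMr// !lt_min.
move=> /andP[w0 /andP[wd wd0]] /andP[k0 /andP[kd kd0]].
rewrite !ler_norml => xs yt.
(* Bounds the first-order error on the rectangle: both coordinate distances to [(x, y)] add up to at
   most [2 * (w + k)], and the tolerance is [e / 8]. *)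
pose eta := e / 4 * (w + k).
have near (s' t' : R) : s <= s' <= s + w -> t <= t' <= t + k ->
    [/\ `|s' - x| < d, `|t' - y| < d, `|s' - x| < d0, `|t' - y| < d0 &
      `|s' - x| + `|t' - y| <= 2 * (w + k)].
  move=> hs ht.
  have hs' : `|s' - x| <= 2 * w by rewrite ler_norml; lra.
  have ht' : `|t' - y| <= 2 * k by rewrite ler_norml; lra.
  by split; lra.
have uE (s' t' : R) : s <= s' <= s + w -> t <= t' <= t + k ->
    `|u s' t' - (u x y + a * (s' - x) + b * y + (- b) * t')| <= eta /\
    `|v s' t' - (v x y + a * (t' - y) - b * x + b * s')| <= eta.
  move=> hs ht; have [h1 h2 h3 h4 h5] := near _ _ hs ht.
  have le : e / 8 * (`|s' - x| + `|t' - y|) <= eta.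
    rewrite /eta; have := ler_wpM2l (ltW e0) h5; lra.
  have [hu hv] := dP _ _ h1 h2; split; apply: le_trans le.
    by apply: le_trans hu; rewrite le_eqVlt; apply/orP; left; apply/eqP; congr (Num.norm _); ring.
  by apply: le_trans hv; rewrite le_eqVlt; apply/orP; left; apply/eqP; congr (Num.norm _); ring.
have PU s' : s <= s' <= s + w ->
    `|U s' (t + k) - U s' t - ((u x y + a * (s' - x) + b * y) * (t + k - t)
       + (- b) * ((t + k) ^+ 2 - t ^+ 2) / 2)| <= eta * (t + k - t).
  move=> hs; apply: (@primitive_affine R (U s') (u s')); first by lra.
    by move=> t' ht; have [h1 h2 h3 h4 h5] := near _ _ hs ht; exact: dU.
  by move=> t' ht; case: (uE _ _ hs ht).
have PV t' : t <= t' <= t + k ->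
    `|V (s + w) t' - V s t' - ((v x y + a * (t' - y) - b * x) * (s + w - s)
       + b * ((s + w) ^+ 2 - s ^+ 2) / 2)| <= eta * (s + w - s).
  move=> ht; apply: (@primitive_affine R (V^~ t') (v^~ t')); first by lra.
    by move=> s' hs; have [h1 h2 h3 h4 h5] := near _ _ hs ht; exact: dV.
  by move=> s' hs; case: (uE _ _ hs ht).
have U1 := PU s; have U2 := PU (s + w); have V1 := PV t; have V2 := PV (t + k).
have {U1}U1 := U1 ltac:(lra); have {U2}U2 := U2 ltac:(lra).
have {V1}V1 := V1 ltac:(lra); have {V2}V2 := V2 ltac:(lra).
have -> : e * (w + k) ^+ 2 = 2 * (eta * k) + 2 * (eta * w) + 2 * (eta * (w + k)).
  by rewrite /eta; field.
have eta0 : 0 <= eta * (w + k).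
  by rewrite /eta mulr_ge0// ?mulr_ge0 ?divr_ge0//; lra.
move: U1 U2 V1 V2; rewrite /mixed_diff !ler_norml.
set u1 := U _ _; set u2 := U _ _; set u3 := U _ _; set u4 := U _ _.
set v1 := V _ _; set v2 := V _ _; set v3 := V _ _; set v4 := V _ _.
lra.
Qed.

(** The complex exponential of [s + i t]. *)
Definition polar (s t : R) : R[i] := (expR s * cos t +i* (expR s * sin t))%C.

Lemma polarD s t s' t' : polar (s + s') (t + t') = polar s t * polar s' t'.
Proof.
rewrite /polar expRD cosD sinD; simpc; apply/eqP; rewrite eq_complex /=.
by apply/andP; split; apply/eqP; ring.
Qed.

Lemma cmod_polar s t : cmod (polar s t) = expR s.
Proof.
rewrite /cmod normc_def /= !exprMn -mulrDr cos2Dsin2 mulr1 sqrtr_sqr.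
by rewrite ger0_norm// expR_ge0.
Qed.

Lemma polar_periodic s t : polar s (t + pi *+ 2) = polar s t.
Proof. by rewrite /polar cosD2pi sinD2pi. Qed.

Lemma is_derive_near (f : R -> R) (x l : R) : is_derive x 1 f l ->
  forall e : R, 0 < e -> exists2 d : R, 0 < d &
    forall h, `|h| < d -> `|f (x + h) - f x - l * h| <= e * `|h|.
Proof.
move=> [df fl] e e0.
have Fl : h^-1 *: (f (h *: 1 + x) - f x) @[h --> 0^'] --> l by rewrite -fl; exact: df.
have lU : nbhs l [set y : R | `|y - l| < e].
  by apply/nbhs_ballP; exists e => // y; rewrite /ball /= distrC.
have /nbhs_ballP [d /= d0 dU] := Fl _ lU.
exists d => // h hd; have [->|h0] := eqVneq h 0.
  by rewrite addr0 subrr mulr0 subrr normr0 mulr0.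
have := dU h; rewrite /ball /= sub0r normrN => /(_ hd h0).
rewrite /GRing.scale /= mulr1 (addrC h) => /ltW H.
have -> : f (x + h) - f x - l * h = (h^-1 * (f (x + h) - f x) - l) * h.
  by rewrite mulrBl mulrAC mulVf// mul1r.
by rewrite normrM ler_wpM2r.
Qed.

Lemma polar_near0 (e : R) : 0 < e -> exists2 d : R, 0 < d &
  forall s t, `|s| < d -> `|t| < d ->
    cmod (polar s t - 1 - (s +i* t)%C) <= e * (`|s| + `|t|).
Proof.
(* The cap [1 / 5] keeps [expR s] below 2; the division by 5 leaves room for the errors of both
   coordinates. *)
move=> e0; have e5 : 0 < Num.min e 1 / 5 by rewrite divr_gt0// lt_min e0 /=.
have ee : Num.min e 1 / 5 <= e / 5 by rewrite ler_pM2r ?ge_min ?lexx.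
have e1 : Num.min e 1 / 5 <= 1 / 5 by rewrite ler_pM2r ?ge_min ?lexx ?orbT.
move: e5 ee e1; set r := Num.min e 1 / 5 => r0 re r1.
have [d1 d1_gt0 d1P] := is_derive_near (is_derive_expR (0 : R)) r0.
have [d2 d2_gt0 d2P] := is_derive_near (is_derive_cos (0 : R)) r0.
have [d3 d3_gt0 d3P] := is_derive_near (is_derive_sin (0 : R)) r0.
(* Tolerance 1 gives [|expR s - 1| <= 2 * |s|], which is at most [r] once [|s| < r / 2]. *)
have [d4 d4_gt0 d4P] := is_derive_near (is_derive_expR (0 : R)) (@ltr01 R).
exists (Num.min (Num.min d1 d2) (Num.min d3 (Num.min d4 (r / 2)))).
  by rewrite !lt_min d1_gt0 d2_gt0 d3_gt0 d4_gt0 divr_gt0.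
move=> s t; rewrite !lt_min => /andP[/andP[s1 s2] /and3P[s3 s4 s5]].
move=> /andP[/andP[t1 t2] /and3P[t3 t4 t5]].
have := d1P s s1; have := d2P t t2; have := d3P t t3; have := d4P s s4.
rewrite !add0r expR0 cos0 sin0 oppr0 mul0r !mul1r oppr0 !addr0.
set E := expR s; set c := cos t; set q := sin t => E4 q3 c2 E1.
have E2 : `|E - 1| <= r.
  by have := ler_normD (E - 1 - s) s; rewrite subrK; lra.
have El : `|E| <= 2.
  by have := ler_normD (E - 1) 1; rewrite subrK normr1; lra.
apply: (le_trans (cmod_le_ReIm _)); simpc; rewrite /= -/E -/c -/q.
have -> : E * c - 1 - s = E * (c - 1) + (E - 1 - s) by ring.
have -> : E * q - t = E * (q - t) + (E - 1) * t by ring.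
have := ler_normD (E * (c - 1)) (E - 1 - s).
have := ler_normD (E * (q - t)) ((E - 1) * t).
rewrite !normrM.
have := ler_pM (normr_ge0 E) (normr_ge0 (c - 1)) El c2.
have := ler_pM (normr_ge0 E) (normr_ge0 (q - t)) El q3.
have := ler_wpM2r (normr_ge0 t) E2.
have := ler_wpM2r (normr_ge0 t) re.
have := ler_wpM2r (normr_ge0 s) re.
have := mulr_ge0 (ltW r0) (normr_ge0 t).
have := mulr_ge0 (ltW r0) (normr_ge0 s).
lra.
Qed.

Local Notation C := (Cplane R).

(** Chain rule: the derivative in [s + i t] is [l * r * polar x y], whose real and imaginary parts
    are the coefficients. Multiplicativity of [polar] reduces everything to its expansion at 0. *)
Lemma cauchy_riemann_polar (f : C -> C) (a : C) (r x y : R) : 0 < r ->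
  derivable f (a + r%:C%C * polar x y) 1 ->
  cauchy_riemann_at (fun s t => complex.Re (f (a + r%:C%C * polar s t)))
    (fun s t => complex.Im (f (a + r%:C%C * polar s t))) x y.
Proof.
move=> r0 /cplane_derivableP [l fl].
pose L : R[i] := l * (r%:C%C * polar x y).
have [M M0 cL] : exists2 M : R, 0 < M & cmod (r%:C%C * polar x y) = M.
  exists (r * expR x); first by rewrite mulr_gt0 ?expR_gt0.
  by rewrite cmodM cmod_polar cmodR gtr0_norm.
exists (complex.Re L), (complex.Im L) => e e0.
have c1 : 0 < cmod l + 1 by rewrite ltr_wpDl ?cmod_ge0.
have e1 : 0 < e / (4 * M) by rewrite divr_gt0// mulr_gt0.
(* The cap 1 gives the crude bound [cmod (q - 1) <= 2 * n]; the other value makes the remainder of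
   [polar] cost at most [e / 2 * n]. *)
have e2 : 0 < Num.min 1 (e / (2 * M * (cmod l + 1))).
  by rewrite lt_min ltr01 /=; apply: divr_gt0 => //; do 2 apply: mulr_gt0 => //.
have [d1 d1_gt0 d1P] := fl _ e1.
have [d2 d2_gt0 d2P] := polar_near0 e2.
exists (Num.min d2 (d1 / (4 * M))).
  by rewrite lt_min d2_gt0 divr_gt0// mulr_gt0.
move=> s t; rewrite !lt_min => /andP[s2 s1] /andP[t2 t1].
have := d2P _ _ s2 t2; set n := `|s - x| + `|t - y|.
set q := polar _ _; set i : R[i] := (_ +i* _)%C => qP.
have n0 : 0 <= n by rewrite addr_ge0.
have qP1 : cmod (q - 1 - i) <= n.
  by apply: (le_trans qP); rewrite ler_piMl// ge_min lexx.
have qP2 : cmod l * M * cmod (q - 1 - i) <= e / 2 * n.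
  have h1 : M * cmod l <= M * (cmod l + 1) by rewrite ler_pM2l// lerDl.
  have h2 : cmod (q - 1 - i) <= e / (2 * M * (cmod l + 1)) * n.
    by apply: (le_trans qP); rewrite ler_wpM2r// ge_min lexx orbT.
  rewrite (mulrC (cmod l)); apply: (le_trans (ler_pM _ (cmod_ge0 _) h1 h2)).
    by apply: mulr_ge0; [exact: ltW|exact: cmod_ge0].
  rewrite le_eqVlt; apply/orP; left; apply/eqP; field.
  by rewrite (gt_eqF M0) (gt_eqF c1).
have ci : cmod i <= n by exact: (cmod_le_ReIm i).
have cq : cmod (q - 1) <= 2 * n.
  by have := cmodD (q - 1 - i) i; rewrite subrK; lra.
have E : polar s t = polar x y * q by rewrite -polarD !(addrC x, addrC y) !subrK.
pose z : R[i] := a + r%:C%C * polar x y.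
pose w : R[i] := a + r%:C%C * polar s t.
have wz : w - z = r%:C%C * polar x y * (q - 1) by rewrite /w /z E; ring.
have cwz : cmod (w - z) <= 2 * M * n.
  by rewrite wz cmodM cL -mulrA [2 * (M * n)]mulrCA ler_pM2l.
have wzd : cmod (w - z) < d1.
  apply: (le_lt_trans cwz); move: s1 t1; rewrite !ltr_pdivlMr ?mulr_gt0//.
  by rewrite /n; lra.
have fwz := d1P w wzd.
have main : cmod (f w - f z - L * i) <= e * n.
  have -> : f w - f z - L * i = (f w - f z - l * (w - z)) + (L * (q - 1 - i)).
    by rewrite wz /L; ring.
  apply: (le_trans (cmodD _ _)); rewrite cmodM /L cmodM cL.
  have : e / (4 * M) * cmod (w - z) <= e / 2 * n.
    apply: (le_trans (ler_wpM2l (ltW e1) cwz)).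
    by rewrite le_eqVlt; apply/orP; left; apply/eqP; field; rewrite gt_eqF.
  lra.
have EL : L = (complex.Re L +i* complex.Im L)%C by case: (L).
split.
  apply: le_trans main; apply: le_trans (cmod_Re _).
  rewrite EL /i; case: (f w) (f z) => [u v] [u' v']; simpc => /=.
  by rewrite le_eqVlt; apply/orP; left; apply/eqP; congr (Num.norm _); ring.
apply: le_trans main; apply: le_trans (cmod_Im _).
rewrite EL /i; case: (f w) (f z) => [u v] [u' v']; simpc => /=.
by rewrite le_eqVlt; apply/orP; left; apply/eqP; congr (Num.norm _); ring.
Qed.

End Polar.

(** * The maximum principle: no peak at an interior point *)

Section MaximumPrinciple.
Variable R : realType.
Local Notation C := (Cplane R).

Lemma cauchy_riemann_continuous (u v : R -> R -> R) (x y : R) :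
  cauchy_riemann_at u v x y ->
  forall e : R, 0 < e -> exists2 d : R, 0 < d &
    forall s t, `|s - x| < d -> `|t - y| < d ->
      `|u s t - u x y| < e /\ `|v s t - v x y| < e.
Proof.
move=> [a [b cr]] e e0; have [d d0 dP] := cr 1 ltr01.
pose M := `|a| + `|b| + 1.
have M0 : 0 < M by rewrite /M; have := normr_ge0 a; have := normr_ge0 b; lra.
exists (Num.min d (e / (5 * M))); first by rewrite lt_min d0 divr_gt0// mulr_gt0.
move=> s t; rewrite !lt_min => /andP[sd s1] /andP[td t1].
have [hu hv] := dP s t sd td.
have ha (k h : R) : `|k| <= M -> `|h| < e / (5 * M) -> `|k * h| <= e / 5.
  move=> kM hM; rewrite normrM.
  have := ler_pM (normr_ge0 k) (normr_ge0 h) kM (ltW hM).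
  suff -> : M * (e / (5 * M)) = e / 5 by [].
  by field; rewrite gt_eqF.
have aM : `|a| <= M by rewrite /M; have := normr_ge0 b; lra.
have bM : `|b| <= M by rewrite /M; have := normr_ge0 a; lra.
have M1 : `|1| <= M.
  by rewrite normr1 /M; have := normr_ge0 b; have := normr_ge0 a; lra.
have hs := ha 1 _ M1 s1; have ht := ha 1 _ M1 t1.
have h1 := ha _ _ aM s1; have h2 := ha _ _ bM s1.
have h3 := ha _ _ aM t1; have h4 := ha _ _ bM t1.
move: hu hv hs ht h1 h2 h3 h4; rewrite !mul1r => hu hv hs ht.
set p1 := a * _; set p2 := b * _; set p3 := a * _; set p4 := b * _.
move: hu hv; rewrite -/p1 -/p2 -/p3 -/p4.
set N1 := `|s - x| in hs *; set N2 := `|t - y| in ht *.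
move=> hu hv h1 h2 h3 h4; move: hu hv h1 h2 h3 h4.
rewrite !ler_norml !ltr_norml; split; lra.
Qed.

Lemma cauchy_riemann_eq (u v u' v' : R -> R -> R) (x y d : R) : 0 < d ->
  (forall s t, `|s - x| < d -> u s t = u' s t /\ v s t = v' s t) ->
  cauchy_riemann_at u v x y -> cauchy_riemann_at u' v' x y.
Proof.
move=> d0 uv [a [b cr]]; exists a, b => e e0.
have [d1 d10 dP] := cr e e0; exists (Num.min d d1).
  by rewrite lt_min d0.
move=> s t; rewrite !lt_min => /andP[s1 s2] /andP[t1 t2].
have [<- <-] := uv s t s1.
have [|<- <-] := uv x y; first by rewrite subrr normr0.
exact: dP.
Qed.

(* By Goursat's lemma in the coordinate [log (z - a)], the mean of [Re f] over
   the circle of radius [r * expR s] does not depend on [s]; letting [s] tend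
   to [-oo] it is [Re (f a)]. *)
Lemma no_interior_peak (f : C -> C) (a : C) (r rho : R) : 0 < r < rho ->
  (forall z : C, cmod (z - a) < rho -> derivable f z 1) ->
  (forall z : C, cmod (z - a) = r -> cmod (f z) < 1) -> f a <> 1.
Proof.
move=> /andP[r0 rrho] df f1 fa.
have rho0 : 0 < rho by exact: lt_trans rrho.
have q1 : 1 < rho / r by rewrite ltr_pdivlMr// mul1r.
have q0 : 0 < rho / r by exact: lt_trans q1.
(* For [s <= sg] the radius [r * expR s] is at most the geometric mean of [r] and [rho], so it stays
   below [rho] with a margin around [s = 0]. *)
pose sg := ln (rho / r) / 2.
have lnq : 0 < ln (rho / r) by rewrite ln_gt0.
have sg0 : 0 < sg by rewrite divr_gt0.
have disc s t : s <= sg -> cmod (a + r%:C%C * polar s t - a) < rho.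
  move=> ssg; rewrite addrAC subrr add0r cmodM cmod_polar cmodR gtr0_norm//.
  rewrite mulrC -ltr_pdivlMr// -(lnK q0) ltr_expR; move: ssg; rewrite /sg; lra.
(* Freezing [s] at [sg] makes [u] and [v] continuous in each variable on the whole line, as
   [continuous_primitive] requires. *)
pose cl s := Num.min s sg.
have cl_le s : cl s <= sg by rewrite ge_min lexx orbT.
have cl_id s : s <= sg -> cl s = s by move=> h; apply/min_idPl.
have clP s x : `|cl s - cl x| <= `|s - x|.
  have := ler_norm (s - x); have := ler_norm (x - s); rewrite distrC ler_norml /cl !minElt.
  by case: (ltP s sg) => h1; case: (ltP x sg) => h2; lra.
pose u0 s t := complex.Re (f (a + r%:C%C * polar s t)).
pose v0 s t := complex.Im (f (a + r%:C%C * polar s t)).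
pose u s t := u0 (cl s) t; pose v s t := v0 (cl s) t.
have cr0 s t : s <= sg -> cauchy_riemann_at u0 v0 s t.
  by move=> h; apply: cauchy_riemann_polar => //; apply: df; exact: disc.
have cr s t : s < sg -> cauchy_riemann_at u v s t.
  move=> ssg; apply: (@cauchy_riemann_eq u0 v0 _ _ _ _ (sg - s)).
  - by rewrite subr_gt0.
  - move=> s' t'; rewrite ltr_norml => hs.
    by rewrite /u /v cl_id //; lra.
  - exact/cr0/ltW.
have cu s : continuous (u s).
  move=> t U /nbhs_ballP [e /= e0 eU].
  have [d d0 dP] := cauchy_riemann_continuous (cr0 _ t (cl_le s)) e0.
  apply/nbhs_ballP; exists d => // y; rewrite /ball /= distrC => yt.
  apply: eU; rewrite /ball /= distrC.
  have [|] := dP (cl s) y _ yt; by rewrite ?subrr ?normr0.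
have cv t : continuous (v^~ t).
  move=> s U /nbhs_ballP [e /= e0 eU].
  have [d d0 dP] := cauchy_riemann_continuous (cr0 _ t (cl_le s)) e0.
  apply/nbhs_ballP; exists d => // x; rewrite /ball /= distrC => xs.
  apply: eU; rewrite /ball /= distrC.
  have [||] := dP (cl x) t; rewrite ?subrr ?normr0//.
  exact: le_lt_trans xs.
pose T : R := pi *+ 2.
have T0 : 0 < T by rewrite pmulrn_rgt0// pi_gt0.
(* One primitive operator serves all continuous [g]: equal functions get equal primitives, which
   later gives [V s T = V s 0] from the periodicity of [v]. *)
have prim (A : R) : exists P : (R -> R) -> (R -> R), forall g : R -> R, continuous g ->
    forall x : R, A < x -> is_derive x 1 (P g) (g x).
  have /choice[P PP] : forall g : R -> R, exists G : R -> R, continuous g ->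
      forall x : R, A < x -> is_derive x 1 G (g x).
    move=> g; have [cg|ncg] := pselect (continuous g); last by exists g.
    by have [G GP] := continuous_primitive A cg; exists G.
  by exists P.
(* The points to be treated have [t >= - T], and their neighbourhoods have radius at most 1. *)
have [PU PUP] := prim (- T - 1).
pose U s := PU (u s).
have UP s t : - T - 1 < t -> is_derive t 1 (U s) (u s t).
  by move=> tT; apply: PUP.
(* The mean of [u s] over a full turn is attained as a value [u s c]. *)
have MU s : exists2 c, 0 < c < T & U s T - U s 0 = u s c * T.
  have [||c] := @MVT R (U s) (u s) 0 T T0.
  - by move=> x; rewrite in_itv /= => xT; apply: UP; lra.
  - apply: derivable_within_continuous => x; rewrite in_itv /= => xT.
    have h : is_derive x 1 (U s) (u s x) by apply: UP; lra.
    exact: ex_derive.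
  by rewrite in_itv /= subr0 => cT ->; exists c.
have [c0 _ I0] := MU 0.
have u00 : u 0 c0 < 1.
  rewrite /u cl_id ?ltW//; apply: (le_lt_trans (ler_norm _)).
  apply: (le_lt_trans (cmod_Re _)); apply: f1.
  by rewrite addrAC subrr add0r cmodM cmod_polar cmodR gtr0_norm// expR0 mulr1.
have [d d0 dP] : exists2 d : R, 0 < d &
    forall z : C, cmod (z - a) < d -> cmod (f z - f a) < 1 - u 0 c0.
  apply: cplane_derivable_continuous; last by rewrite subr_gt0.
  by apply: df; rewrite subrr cmod0.
have dr0 : 0 < d / r by rewrite divr_gt0.
(* The circle at [s0] has radius below [d], so [u] exceeds [u 0 c0] on it; the bound [-1] makes [s0]
   negative. *)
pose s0 := Num.min (-1) (ln (d / r) - 1).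
have s01 : s0 <= -1 by rewrite ge_min lexx.
have s02 : s0 < ln (d / r).
  by apply: (@le_lt_trans _ _ (ln (d / r) - 1)); [rewrite ge_min lexx orbT|lra].
have [c1 _ I1] := MU s0.
have u01 : u 0 c0 < u s0 c1.
  have : cmod (f (a + r%:C%C * polar s0 c1) - f a) < 1 - u 0 c0.
    apply: dP; rewrite addrAC subrr add0r cmodM cmod_polar cmodR gtr0_norm//.
    by rewrite mulrC -ltr_pdivlMr// -(lnK dr0) ltr_expR.
  move/(le_lt_trans (cmod_Re _)); rewrite raddfB /= fa /= ltr_norml.
  have -> : u s0 c1 = u0 s0 c1 by rewrite /u cl_id//; lra.
  by rewrite -/(u0 s0 c1); lra.
(* Likewise the points to be treated have [s >= 2 * s0], again with a margin of 1. *)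
have [PV PVP] := prim (s0 - 1 - - s0).
pose V s t := PV (v^~ t) s.
have VP s t : s0 - 1 - - s0 < s -> is_derive s 1 (fun s' => V s' t) (v s t).
  by move=> ss; apply: (PVP (v^~ t)).
have s0W : 0 < - s0 by lra.
have := @mixed_diff_eq0 R (fun s t => U s t - V s t) s0 0 (- s0) T s0W T0.
have VT s : V s T = V s 0.
  rewrite /V; congr (PV _ _); apply/funext => s'.
  by rewrite /v /v0 /T -[pi *+ 2]add0r polar_periodic.
rewrite /mixed_diff subrr add0r !VT => H.
have : U s0 T - U s0 0 = U 0 T - U 0 0.
  suff : U 0 T - V 0 0 - (U 0 0 - V 0 0) - (U s0 T - V s0 0) + (U s0 0 - V s0 0) = 0 by lra.
  apply: H => x y; rewrite subr0 !ler_norml => xs yT.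
  apply: (@cauchy_riemann_mixed_diff R u v U V x y (Num.min 1 (sg - x))).
  - by rewrite lt_min ltr01 subr_gt0; lra.
  - by apply: cr; lra.
  - move=> s t _; rewrite lt_min ltr_norml => /andP[ty _]; apply: UP; lra.
  - move=> s t; rewrite lt_min ltr_norml => /andP[sx _] _; apply: VP; lra.
rewrite I0 I1 => /(mulIf (lt0r_neq0 T0)) E.
by rewrite E ltxx in u01.
Qed.

End MaximumPrinciple.

(** * Continuing a square root of [(w - p) / (w - q)] while [q] moves *)

Section Root.
Variable R : realType.
Local Notation C := (Cplane R).
Implicit Types (K : set C) (c p q w z : C).

Lemma half_plane_sqrt : exists sq : R[i] -> R[i],
  forall x, sq x ^+ 2 = x /\ 0 <= complex.Re (sq x).
Proof.
suff /choice[sq sqP] : forall x : R[i], exists s : R[i], s ^+ 2 = x /\ 0 <= complex.Re s.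
  by exists sq.
move=> x; have [h|h] := lerP 0 (complex.Re (sqrtc x)).
  by exists (sqrtc x); rewrite sqr_sqrtc.
exists (- sqrtc x); rewrite sqrrN sqr_sqrtc raddfN /=; split => //.
by rewrite oppr_ge0 ltW.
Qed.

Lemma Re_le_cmod (x : R[i]) : complex.Re x <= cmod x.
Proof. exact: le_trans (ler_norm _) (cmod_Re x). Qed.

Lemma within_continuousP K (f : C -> C) : {within K, continuous f} <->
  forall z, K z -> f w @[w --> within K (nbhs z)] --> f z.
Proof. exact: subspace_continuousP. Qed.

(* The last clause selects, far from [c], the branch tending to 1 at infinity. *)
Definition sqrt_branch K c (r : R) p q := exists S : C -> C,
  {within K, continuous S} /\
  forall w, K w -> S w ^+ 2 * (w - q) = w - p /\
    (9 * r <= cmod (w - c) -> cmod (S w - 1) <= 1 / 4).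

Lemma sqrt_branch_refl K c r p : sqrt_branch K c r p p.
Proof.
exists (fun=> 1); split; first exact: cst_continuous.
by move=> w _; rewrite expr1n mul1r subrr cmod0; split => // _; lra.
Qed.

(** The branch is multiplied by [T], the root of [(w - q) / (w - q')] in the right half plane. As
    this quotient stays within [1 / 2] of 1 on [K], [T] has real part at least [1 / 2] there and is
    continuous. *)
Lemma sqrt_branch_step K c r p q q' : 0 < r ->
  cmod (p - c) < r -> cmod (q - c) < r -> cmod (q' - c) < r -> ~ K q' ->
  (forall w, K w -> 2 * cmod (q - q') <= cmod (w - q')) ->
  sqrt_branch K c r p q -> sqrt_branch K c r p q'.
Proof.
move=> r0 pc qc qc' Kq' qq' [S [cS SP]].
have [sq sqP] := half_plane_sqrt.
pose phi w : C := (w - q) / (w - q').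
pose T w : C := sq (phi w).
have wq' w : K w -> w - q' != 0.
  by move=> Kw; rewrite subr_eq0; apply/eqP => wq; apply: Kq'; rewrite -wq.
have phi1 w : K w -> (phi w - 1) * (w - q') = q' - q.
  by move=> Kw; rewrite mulrBl /phi mulfVK ?wq'// mul1r; ring.
have T2 w : T w ^+ 2 = phi w by case: (sqP (phi w)).
have T0 w : 0 <= complex.Re (T w) by case: (sqP (phi w)).
have T1 w : 1 <= cmod (T w + 1).
  by apply: le_trans (Re_le_cmod _); rewrite raddfD /= lerDr.
have TE w : (T w - 1) * (T w + 1) = phi w - 1 by rewrite -T2; ring.
have cphi w : K w -> cmod (phi w - 1) * cmod (w - q') = cmod (q - q').
  by move=> Kw; rewrite -cmodM phi1// cmodBC.
have phi_half w : K w -> cmod (phi w - 1) <= 1 / 2.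
  move=> Kw; have w0 : 0 < cmod (w - q') by rewrite cmod_gt0 wq'.
  by have := qq' w Kw; rewrite -(cphi w Kw) mulrA ger_pMl//; lra.
have T12 w : cmod (T w - 1) <= cmod (phi w - 1).
  by rewrite -TE cmodM ler_peMr ?cmod_ge0.
have Th w : K w -> 1 / 2 <= complex.Re (T w).
  move=> /phi_half h; have := le_trans (cmod_Re _) (le_trans (T12 w) h).
  rewrite raddfB /= ler_norml; lra.
have cT : {within K, continuous T}.
  apply/cplane_continuousP => z Kz e e0.
  have cphiK : {within K, continuous phi}.
    apply/within_continuousP => x Kx; apply: cvg_within_filter.
    apply: cvgM; first by apply: cvgB; [exact: cvg_id|exact: cvg_cst].
    by apply: cvgV; [exact: wq'|apply: cvgB; [exact: cvg_id|exact: cvg_cst]].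
  have [d d0 dP] := (cplane_continuousP K phi).1 cphiK z Kz e e0.
  exists d => // w Kw wz; apply: le_lt_trans (dP w Kw wz).
  have -> : phi w - phi z = (T w - T z) * (T w + T z) by rewrite -!T2; ring.
  rewrite cmodM ler_peMr ?cmod_ge0//.
  apply: le_trans (Re_le_cmod _); rewrite raddfD /=.
  by have := Th w Kw; have := Th z Kz; lra.
exists (fun w => S w * T w); split.
  apply/within_continuousP => z Kz.
  by apply: cvgM; [move/within_continuousP: cS|move/within_continuousP: cT]; exact.
move=> w Kw; have [Sw S1] := SP w Kw.
have E : (S w * T w) ^+ 2 * (w - q') = w - p.
  by rewrite exprMn T2 -mulrA /phi mulfVK ?wq'.
split => // wc; have {}S1 := S1 wc.
have wqr : 8 * r <= cmod (w - q').
  have := cmod_dist w q' c; lra.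
(* Here [x] is [(q' - y) / (w - q')], with numerator at most [2 * r] and denominator at least
   [8 * r]. *)
have small (x y : C) : cmod (y - c) < r -> x * (w - q') = q' - y -> cmod x <= 1 / 4.
  move=> yc xE; have : cmod x * cmod (w - q') <= 2 * r.
    rewrite -cmodM xE; apply: (le_trans (cmod_dist _ c _)).
    rewrite (cmodBC c); lra.
  have := cmod_ge0 x; nra.
have T14 : cmod (T w - 1) <= 1 / 4.
  by apply: (le_trans (T12 w)); apply: (small _ _ qc); exact: phi1.
(* The crude bound [9 / 16] keeps the product away from -1; factoring its square minus 1 then
   restores [1 / 4], so nothing deteriorates along a chain of moves. *)
have ST1 : cmod (S w * T w - 1) <= 9 / 16.
  have -> : S w * T w - 1 = (S w - 1) * (T w - 1) + ((S w - 1) + (T w - 1)) by ring.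
  apply: (le_trans (cmodD _ _)); have := cmodD (S w - 1) (T w - 1).
  rewrite cmodM; have := ler_pM (cmod_ge0 _) (cmod_ge0 _) S1 T14; lra.
have ST2 : 1 <= cmod (S w * T w + 1).
  have := cmodD (S w * T w + 1) (- (S w * T w - 1)).
  have -> : S w * T w + 1 + - (S w * T w - 1) = 2%:R by ring.
  rewrite cmod_nat cmodN; lra.
have ST3 : cmod ((S w * T w - 1) * (S w * T w + 1)) <= 1 / 4.
  apply: (small _ _ pc).
  have -> : (S w * T w - 1) * (S w * T w + 1) = (S w * T w) ^+ 2 - 1 by ring.
  by rewrite mulrBl E mul1r; ring.
apply: le_trans ST3; rewrite cmodM ler_peMr ?cmod_ge0//.
Qed.

Lemma dist_compl_closed K q : closed K -> ~ K q ->
  exists2 r : R, 0 < r & forall w, K w -> r <= cmod (w - q).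
Proof.
move=> clK Kq.
have /cplane_interiorP [r r0 rP] : interior (~` K) q.
  by have := closed_openC clK; rewrite openE; exact.
exists r => // w Kw; rewrite leNgt; apply/negP => /rP; exact.
Qed.

(* Otherwise the points reachable from [p] would form a bounded clopen part of
   the connected unbounded set [~` K]. *)
Lemma sqrt_branch_far K c r p : compact K -> connected (~` K) ->
  ~ K p -> cmod (p - c) < r / 2 ->
  exists q, [/\ ~ K q, cmod (q - c) < r, r / 2 <= cmod (q - c) &
    sqrt_branch K c r p q].
Proof.
move=> cptK conK Kp pc.
have clK := cplane_compact_closed cptK.
have r0 : 0 < r by have := cmod_ge0 (p - c); lra.
apply: contrapT => nq.
pose B := [set q | [/\ ~ K q, cmod (q - c) < r & sqrt_branch K c r p q]].
have Bsmall q : B q -> cmod (q - c) < r / 2.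
  by move=> [h1 h2 h3]; rewrite ltNge; apply/negP => h4; apply: nq; exists q.
have Bp : B p by split => //; [lra|exact: sqrt_branch_refl].
have oB : open B.
  rewrite openE => q [Kq qc bq]; have [d d0 dP] := dist_compl_closed clK Kq.
  (* A move below [d / 3] leaves [q'] farther than [2 * d / 3] from [K], at least twice the move. *)
  apply/cplane_interiorP; exists (Num.min (d / 3) (r - cmod (q - c))).
    by rewrite lt_min subr_gt0 qc divr_gt0.
  move=> q'; rewrite lt_min => /andP[h1 h2].
  have q'c : cmod (q' - c) < r by have := cmod_dist q' q c; lra.
  have wq' w : K w -> 2 * cmod (q - q') <= cmod (w - q').
    by move=> /dP; have := cmod_dist w q' q; rewrite (cmodBC q); lra.
  have Kq' : ~ K q'.
    move=> /dP; lra.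
  by split => //; apply: sqrt_branch_step bq => //; lra.
have clB : B = ~` K `&` closure B.
  apply/seteqP; split=> [q Bq|q [Kq clq]].
    by split; [case: Bq|exact: subset_closure].
  have [d d0 dP] := dist_compl_closed clK Kq.
  (* The new pole is now [q] itself, at distance at least [d] from [K], so a move below [d / 2]
     suffices; [r / 4] keeps [q] within [3 * r / 4] of [c]. *)
  have [|q1 Bq1] := (cplane_closureP B q).1 clq (Num.min (d / 2) (r / 4)).
    by rewrite lt_min !divr_gt0.
  rewrite lt_min => /andP[h1 h2].
  have q1c := Bsmall _ Bq1; have [Kq1 q1r bq1] := Bq1.
  have qc : cmod (q - c) < r.
    by have := cmod_dist q q1 c; rewrite (cmodBC q q1); lra.
  split => //; apply: sqrt_branch_step bq1 => //; first by lra.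
  by move=> w /dP; lra.
have BK : B = ~` K.
  apply: conK.
  - by exists p.
  - exists B => //; apply/seteqP; split=> [q Bq|q []//].
    by split => //; case: Bq.
  - by exists (closure B) => //; exact: closed_closure.
have [M MP] := cplane_compact_bounded c cptK.
(* Large enough that [c + b] lies outside [K] and too far from [c] to be in [B]. *)
pose b : R := `|M| + r + 1.
have b0 : 0 < b by rewrite /b; have := normr_ge0 M; lra.
have cb : cmod (c + b%:C%C - c) = b.
  by rewrite addrAC subrr add0r cmodR gtr0_norm.
have [/MP|] := pselect (K (c + b%:C%C)).
  by rewrite cb /b; have := ler_norm M; lra.
move=> nK; have : B (c + b%:C%C) by rewrite BK.
by move/Bsmall; rewrite cb /b; have := normr_ge0 M; lra.
Qed.

End Root.

(** * Approximate peak functions at a boundary point *)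

Section Bump.
Variable R : realType.
Local Notation C := (Cplane R).
Implicit Types (K : set C) (c p q w z : C).

Lemma caratheodory_derivable (f Q : C -> C) z (d : R) : 0 < d ->
  (forall w, cmod (w - z) < d -> f w - f z = Q w * (w - z)) ->
  {for z, continuous Q} -> derivable f z 1.
Proof.
move=> d0 fQ cQ; apply/cplane_derivableP; exists (Q z) => e e0.
have fU : nbhs (Q z) [set y : C | cmod (y - Q z) < e].
  by apply/cplane_nbhsP; exists e.
have /cplane_nbhsP [d1 d10 dP] := cQ _ fU.
exists (Num.min d d1); first by rewrite lt_min d0.
move=> w; rewrite lt_min => /andP[h1 h2].
rewrite fQ// -mulrBl cmodM ler_wpM2r ?cmod_ge0// ltW//; exact: dP.
Qed.

Lemma quotient_scale (F : fieldType) (x y A N m k : F) : N != 0 ->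
  (x - y) * N = A * m -> x * k - y * k = k * A / N * m.
Proof.
move=> N0 E; apply: (mulIf N0).
have -> : k * A / N * m * N = k * (A * m) by field.
by rewrite -E; ring.
Qed.

(** Smallness off the disc of radius [rho] will make a series of such functions peak; the Lipschitz
    bound there controls its difference quotients. *)
Definition bump K c (M rho : R) (g : C -> C) :=
  [/\ {within K, continuous g}, forall z, interior K z -> derivable g z 1,
    g c = 1, forall w, K w -> cmod (g w) <= M &
    forall w, K w -> rho <= cmod (w - c) ->
      cmod (g w) <= rho /\
      forall z, K z -> rho <= cmod (z - c) -> cmod (g w - g z) <= cmod (w - z)].

(* Up to a constant, [g] is the Joukowski coordinate [h] of the plane slit from
   [p] to [q], i.e. the solution of [h + h^-1 = (2 (q + p) - 4 w) / (q - p)]. *)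
Lemma approximate_peak K c (rho : R) : compact K -> connected (~` K) ->
  K c -> ~ interior K c -> 0 < rho ->
  exists g : C -> C, bump K c 400 rho g.
Proof.
move=> cptK conK Kc nKc rho0.
(* [9 * d <= rho] makes the far clause of [sqrt_branch] apply off the disc of radius [rho];
   [30 * d <= rho ^+ 2] turns the bound [d / rho] on [h] into [rho / 30]. *)
pose d := Num.min (rho / 9) (rho ^+ 2 / 30).
have d0 : 0 < d by rewrite lt_min !divr_gt0// exprn_gt0.
have d9 : 9 * d <= rho.
  have : d <= rho / 9 by rewrite ge_min lexx.
  lra.
have d30 : 30 * d <= rho ^+ 2.
  have : d <= rho ^+ 2 / 30 by rewrite ge_min lexx orbT.
  lra.
clearbody d.
(* As [q] will be at least [d / 2] away from [c], the radius [d / 32] gives [|S c| ^+ 2 <= 1 / 16],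
   hence [|h c| >= 3 / 5]. *)
have [p Kp pc] : exists2 p, ~ K p & cmod (p - c) < d / 32.
  apply: contrapT => np; apply: nKc; apply/cplane_interiorP; exists (d / 32).
    by rewrite divr_gt0.
  by move=> w wc; apply: contrapT => Kw; apply: np; exists w.
have pc2 : cmod (p - c) < d / 2 by lra.
have [q [Kq qc qc2 [S [cS SP]]]] := sqrt_branch_far cptK conK Kp pc2.
pose D := q - p.
have D1 : d / 4 <= cmod D.
  by have := cmod_dist q p c; rewrite -/D; lra.
have D2 : cmod D <= 2 * d.
  by have := cmod_dist q c p; rewrite -/D (cmodBC c); lra.
have D0 : D != 0 by rewrite -cmod_gt0; lra.
have wq w : K w -> w - q != 0.
  by move=> Kw; rewrite subr_eq0; apply/eqP => E; apply: Kq; rewrite -E.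
have wp w : K w -> w - p != 0.
  by move=> Kw; rewrite subr_eq0; apply/eqP => E; apply: Kp; rewrite -E.
have SD w : K w -> (1 - S w ^+ 2) * (w - q) = - D.
  by move=> Kw; rewrite mulrBl (SP w Kw).1 /D; ring.
have S21 w : K w -> 1 - S w ^+ 2 != 0.
  by move=> Kw; apply: contra_neq D0 => E; rewrite -[D]opprK -(SD w Kw) E mul0r oppr0.
have Sfac w : 1 - S w ^+ 2 = (1 - S w) * (1 + S w) by ring.
have S1 w : K w -> 1 + S w != 0.
  by move=> /S21; rewrite Sfac mulf_eq0 negb_or => /andP[].
have Sm1 w : K w -> 1 - S w != 0.
  by move=> /S21; rewrite Sfac mulf_eq0 negb_or => /andP[].
have S0 w : K w -> S w != 0.
  move=> Kw; apply: contra_neq (wp w Kw) => E.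
  by rewrite -(SP w Kw).1 E expr0n /= mul0r.
pose h w : C := (1 - S w) / (1 + S w).
have hS w : K w -> h w * (1 + S w) = 1 - S w.
  by move=> Kw; rewrite /h mulfVK// S1.
have SE w : K w -> (1 + h w) * S w = 1 - h w.
  move=> Kw; apply/eqP; rewrite -subr_eq0; apply/eqP.
  have -> : (1 + h w) * S w - (1 - h w) = h w * (1 + S w) - (1 - S w) by ring.
  by rewrite hS// subrr.
have hw w : K w -> h w * (2 * (q + p) - 4 * w) = D * (1 + h w ^+ 2).
  move=> Kw; have e1 := (SP w Kw).1; have e2 := SE w Kw.
  have : (1 - h w) ^+ 2 * (w - q) = (1 + h w) ^+ 2 * (w - p).
    by rewrite -e1 -e2 mulrA exprMn.
  move/eqP; rewrite -subr_eq0 => /eqP E; apply/eqP; rewrite -subr_eq0 -E /D.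
  by apply/eqP; ring.
(* Combining the quadratic equations at [w] and [z] exposes the difference quotient of [h], which
   yields both holomorphy and the Lipschitz bound. *)
have hdiff w z : K w -> K z ->
    (h w - h z) * (D * (1 - h w * h z)) = 4 * (h w * h z) * (w - z).
  move=> Kw Kz.
  have -> : (h w - h z) * (D * (1 - h w * h z)) =
    h w * (D * (1 + h z ^+ 2)) - h z * (D * (1 + h w ^+ 2)) by ring.
  by rewrite -!hw//; ring.
have h21 z : K z -> D * (1 - h z * h z) != 0.
  move=> Kz; apply: mulf_neq0 => //.
  have -> : 1 - h z * h z = 4 * S z / (1 + S z) ^+ 2.
    by rewrite /h; field; rewrite S1.
  by rewrite !mulf_neq0 ?invr_eq0 ?expf_neq0 ?S0 ?S1 ?pnatr_eq0.
(* A zero would force [h w * h z = 0], leaving [D = 0], or [w = z], the case of [h21]. *)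
have h12 w z : K w -> K z -> D * (1 - h w * h z) != 0.
  move=> Kw Kz; apply/eqP => E.
  have /eqP := hdiff w z Kw Kz; rewrite E mulr0 eq_sym mulf_eq0 subr_eq0.
  case/orP => [|/eqP wz]; last by have := h21 z Kz; rewrite -{1}wz E eqxx.
  rewrite mulf_eq0 pnatr_eq0 /= => /eqP E1.
  by move/eqP: E; rewrite E1 subr0 mulr1 (negbTE D0).
have ch : {within K, continuous h}.
  apply/within_continuousP => z Kz.
  have cSz : S w @[w --> within K (nbhs z)] --> S z by move/within_continuousP: cS; exact.
  apply: cvgM; first by apply: cvgB; [exact: cvg_cst|exact: cSz].
  by apply: cvgV; [exact: S1|apply: cvgD; [exact: cvg_cst|exact: cSz]].
have dh k z : interior K z -> derivable (fun w => h w * k) z 1.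
  move=> iz; have Kz : K z by exact: interior_subset.
  have /cplane_interiorP [r r0 rP] := iz.
  have chz : h w @[w --> z] --> h z.
    move=> U /cplane_nbhsP [e e0 eU].
    have [r1 r10 r1P] := (cplane_continuousP K h).1 ch z Kz e e0.
    apply/cplane_nbhsP; exists (Num.min r r1); first by rewrite lt_min r0.
    by move=> w; rewrite lt_min => /andP[/rP Kw wr]; apply: eU; exact: r1P.
  pose Q w : C := k * (4 * (h w * h z)) / (D * (1 - h w * h z)).
  apply: (@caratheodory_derivable _ Q z r r0).
    move=> w /rP Kw.
    exact: (quotient_scale k (h12 w z Kw Kz) (hdiff w z Kw Kz)).
  have chk : h w * h z @[w --> z] --> h z * h z.
    exact: (cvgM chz (cvg_cst _)).
  have cA : k * (4 * (h w * h z)) @[w --> z] --> k * (4 * (h z * h z)).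
    exact: (cvgM (cvg_cst _) (cvgM (cvg_cst _) chk)).
  have cN : D * (1 - h w * h z) @[w --> z] --> D * (1 - h z * h z).
    exact: (cvgM (cvg_cst _) (cvgB (cvg_cst _) chk)).
  exact: (cvgM cA (cvgV (h21 z Kz) cN)).
have X_wq w : K w -> cmod (1 - S w ^+ 2) * cmod (w - q) = cmod D.
  by move=> Kw; rewrite -cmodM SD// cmodN.
have hc : 3 / 5 <= cmod (h c).
  have Sc : cmod (S c) <= 1 / 4.
    have : cmod (S c) ^+ 2 * cmod (c - q) = cmod (c - p).
      by rewrite -(SP c Kc).1 cmodM [in RHS]expr2 cmodM.
    rewrite !(cmodBC c) => E; rewrite leNgt; apply/negP => Sc.
    have Sc2 : 1 / 16 < cmod (S c) ^+ 2 by have := cmod_ge0 (S c); nra.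
    have : 1 / 16 * (d / 2) <= cmod (S c) ^+ 2 * cmod (q - c).
      by apply: ler_pM; [lra|lra|exact: ltW|exact: qc2].
    lra.
  have h1 : cmod (h c) * cmod (1 + S c) = cmod (1 - S c) by rewrite -cmodM hS.
  have h2 : cmod (1 + S c) <= 5 / 4 by have := cmodD 1 (S c); rewrite cmod1; lra.
  have h3 : 3 / 4 <= cmod (1 - S c).
    by have := cmodD (1 - S c) (S c); rewrite subrK cmod1; lra.
  have := ler_wpM2l (cmod_ge0 (h c)) h2; lra.
have hc0 : h c != 0 by rewrite -cmod_gt0; lra.
have S14 w : K w -> 9 * d <= cmod (w - c) -> 7 / 4 <= cmod (1 + S w).
  move=> Kw wc; have := (SP w Kw).2 wc.
  have := cmodD (1 + S w) (- (S w - 1)).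
  have -> : 1 + S w + - (S w - 1) = 2%:R by ring.
  by rewrite cmod_nat cmodN; lra.
have hX w : K w -> cmod (h w) * cmod (1 + S w) ^+ 2 = cmod (1 - S w ^+ 2).
  by move=> Kw; rewrite Sfac -hS// !cmodM expr2 mulrA.
(* From [h = (1 - S ^+ 2) / (1 + S) ^+ 2], with [|1 - S ^+ 2| = |D| / |w - q|] and
   [|1 + S| >= 7 / 4]. *)
have hfar w : K w -> rho <= cmod (w - c) -> cmod (h w) * rho <= d.
  move=> Kw wc; have S7 : 7 / 4 <= cmod (1 + S w) by apply: S14 => //; lra.
  have wq1 : 8 / 9 * rho <= cmod (w - q).
    by have := cmod_dist w q c; lra.
  have h1 : cmod (1 - S w ^+ 2) * (8 / 9 * rho) <= 2 * d.
    by apply: le_trans D2; rewrite -(X_wq w Kw) ler_wpM2l ?cmod_ge0.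
  have h2 : cmod (h w) * (49 / 16) <= cmod (1 - S w ^+ 2).
    by rewrite -hX// ler_wpM2l ?cmod_ge0//; nra.
  have := ler_wpM2r (ltW rho0) h2; lra.
(* Near [c], [X = |1 - S ^+ 2|] is at least [1 / 40], and [h = (1 - S) ^+ 2 / (1 - S ^+ 2)] has
   modulus at most [(4 + 2 * X) / X]. Division by [h c] turns 240 into 400. *)
have hB w : K w -> cmod (h w) <= 240.
  move=> Kw; have [wc|wc] := lerP (9 * d) (cmod (w - c)).
    have S7 := S14 w Kw wc; have h1 : cmod (h w) * cmod (1 + S w) = cmod (1 - S w).
      by rewrite -cmodM hS.
    have := ler_wpM2l (cmod_ge0 (h w)) S7; rewrite h1 cmodBC.
    have := (SP w Kw).2 wc; lra.
  have wq1 : cmod (w - q) <= 10 * d.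
    by have := cmod_dist w c q; rewrite (cmodBC c); lra.
  have X1 : 1 / 40 <= cmod (1 - S w ^+ 2).
    have := ler_wpM2l (cmod_ge0 (1 - S w ^+ 2)) wq1.
    by rewrite (X_wq w Kw) => h1; rewrite -(ler_pM2r d0); lra.
  have h1 : cmod (h w) * cmod (1 - S w ^+ 2) = cmod (1 - S w) ^+ 2.
    by rewrite Sfac -cmodM mulrCA hS// cmodM expr2.
  have h2 : cmod (1 - S w) <= 1 + cmod (S w).
    by have := cmodD 1 (- S w); rewrite cmod1 cmodN.
  have h3 : cmod (S w) ^+ 2 <= 1 + cmod (1 - S w ^+ 2).
    have := cmodD 1 (- (1 - S w ^+ 2)); rewrite cmod1 cmodN.
    have -> : 1 + - (1 - S w ^+ 2) = S w * S w by ring.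
    by rewrite cmodM expr2.
  have h4 : cmod (1 - S w) ^+ 2 <= 4 + 2 * cmod (1 - S w ^+ 2).
    have := sqr_ge0 (1 - cmod (S w)).
    have := ler_pM (cmod_ge0 _) (cmod_ge0 _) h2 h2; lra.
  rewrite leNgt; apply/negP => h5.
  have := ler_wpM2r (cmod_ge0 (1 - S w ^+ 2)) (ltW h5); lra.
(* The factor [3 / 5] makes the Lipschitz constant 1 after division by [h c]. *)
have hlip w z : K w -> K z -> rho <= cmod (w - c) -> rho <= cmod (z - c) ->
    cmod (h w - h z) <= 3 / 5 * cmod (w - z).
  move=> Kw Kz wc zc; have hw1 := hfar w Kw wc; have hz1 := hfar z Kz zc.
  have E : cmod (h w - h z) * (cmod D * cmod (1 - h w * h z)) =
      4 * (cmod (h w) * cmod (h z)) * cmod (w - z).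
    by rewrite -!cmodM hdiff// !cmodM cmod_nat.
  have hh : cmod (h w) * cmod (h z) * 30 <= d.
    rewrite -(ler_pM2r d0); have pos w' := mulr_ge0 (cmod_ge0 (h w')) (ltW rho0).
    have := ler_pM (pos w) (pos z) hw1 hz1.
    have := ler_wpM2l (mulr_ge0 (cmod_ge0 (h w)) (cmod_ge0 (h z))) d30.
    lra.
  have h9 w' : cmod (h w') * rho <= d -> cmod (h w') <= 1 / 9.
    by move=> h1; rewrite -(ler_pM2r rho0); lra.
  have h81 : 80 / 81 <= cmod (1 - h w * h z).
    have := cmodD (1 - h w * h z) (h w * h z); rewrite subrK cmod1 cmodM.
    have := ler_pM (cmod_ge0 _) (cmod_ge0 _) (h9 _ hw1) (h9 _ hz1); lra.
  have h1 : d / 4 * (80 / 81) <= cmod D * cmod (1 - h w * h z).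
    by apply: ler_pM => //; lra.
  rewrite -(ler_pM2r d0); have := ler_wpM2l (cmod_ge0 (h w - h z)) h1.
  have := ler_wpM2r (cmod_ge0 (w - z)) hh.
  by have := mulr_ge0 (ltW d0) (cmod_ge0 (w - z)); rewrite E; lra.
have ic : cmod (h c)^-1 <= 5 / 3.
  rewrite cmodV -[5 / 3]invrK lef_pV2 ?posrE ?invr_gt0 ?divr_gt0 ?cmod_gt0//.
  by rewrite invf_div.
exists (fun w => h w * (h c)^-1); split.
- apply/within_continuousP => z Kz.
  apply: cvgM; last exact: cvg_cst.
  by move/within_continuousP: ch; exact.
- by move=> z; exact: dh.
- by rewrite mulfV.
- move=> w /hB hw240; rewrite cmodM; have := ler_pM (cmod_ge0 _) (cmod_ge0 _) hw240 ic; lra.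
move=> w Kw wc; split.
  have h1 := hfar w Kw wc; have h2 : cmod (h w) * 30 <= rho.
    by rewrite -(ler_pM2r rho0) mulrAC -expr2; lra.
  rewrite cmodM; have := ler_wpM2l (cmod_ge0 (h w)) ic; lra.
move=> z Kz zc; rewrite -mulrBl cmodM.
have := ler_pM (cmod_ge0 _) (cmod_ge0 _) (hlip w z Kw Kz wc zc) ic; lra.
Qed.

End Bump.

(** * Summing the bumps to a function peaking exactly at [c] *)

Section Peak.
Variable R : realType.
Local Notation C := (Cplane R).
Implicit Types (K : set C) (c w z : C).

Lemma within_continuous_axpy K (f g : C -> C) (k : C) :
  {within K, continuous f} -> {within K, continuous g} ->
  {within K, continuous (fun w => f w + k * g w)}.
Proof.
move=> /within_continuousP cf /within_continuousP cg.
apply/within_continuousP => z Kz.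
apply: cvgD; first exact: cf.
by apply: cvgM; [exact: cvg_cst|exact: cg].
Qed.

Lemma derivable_axpy (f g : C -> C) (k : C) z :
  derivable f z 1 -> derivable g z 1 -> derivable (fun w => f w + k * g w) z 1.
Proof.
move=> df dg; apply: derivableD; first exact: df.
by apply: derivableM; [exact: derivable_cst|exact: dg].
Qed.

Lemma expr_small (s b : R) : 0 <= s < 1 -> 0 < b -> exists n, s ^+ n < b.
Proof.
move=> /andP[s0 s1] b0; have := @cvg_expr R s.
rewrite ger0_norm// => /(_ s1) /cvgrPdist_lt /(_ b b0) [n _ /(_ n (leqnn n))].
by rewrite /= sub0r normrN ger0_norm ?exprn_ge0//; exists n.
Qed.

(* Difference quotients at [z] converge uniformly, so the derivatives of the
   [P m] form a Cauchy sequence whose limit is the derivative of [F]. *)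
Lemma derivable_lim (P : nat -> C -> C) (F : C -> C) z (r : R) (b : nat -> R) :
  0 < r -> (forall m n, (m <= n)%N -> b n <= b m) ->
  (forall e : R, 0 < e -> exists m, b m < e) -> (forall m, 0 < b m) ->
  (forall m, derivable (P m) z 1) ->
  (forall m w, cmod (w - z) < r ->
     cmod ((F w - F z) - (P m w - P m z)) <= b m * cmod (w - z)) ->
  derivable F z 1.
Proof.
move=> r0 bm b_small b0 dP FP.
have /choice[l lP] : forall m, exists l : C, forall e : R, 0 < e ->
    exists2 d : R, 0 < d & forall w, cmod (w - z) < d ->
      cmod (P m w - P m z - l * (w - z)) <= e * cmod (w - z).
  by move=> m; have /cplane_derivableP := dP m.
have lC m n : (m <= n)%N -> cmod (l n - l m) <= 4 * b m.
  move=> mn; have [d1 d10 d1P] := lP m _ (b0 m); have [d2 d20 d2P] := lP n _ (b0 m).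
  (* A test distance at which both linear approximations and the hypothesis on [F] apply. *)
  pose d := Num.min (Num.min d1 d2) r / 2.
  have dd : 0 < Num.min (Num.min d1 d2) r by rewrite !lt_min d10 d20 r0.
  have d0 : 0 < d by rewrite divr_gt0.
  have := ltr_pdivrMr d d (ltr0Sn R 1).
  pose w : C := z + d%:C%C.
  have wz : cmod (w - z) = d by rewrite /w addrAC subrr add0r cmodR gtr0_norm.
  have : d < Num.min (Num.min d1 d2) r by rewrite ltr_pdivrMr// ltr_pMr// ltr1n.
  rewrite -wz !lt_min => /andP[/andP[w1 w2] w3] _.
  have h1 := d1P _ w1; have h2 := d2P _ w2; have h3 := FP m _ w3; have h4 := FP n _ w3.
  have h5 : b n * cmod (w - z) <= b m * cmod (w - z).
    by rewrite ler_wpM2r ?cmod_ge0// bm.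
  rewrite -(ler_pM2r d0) -{1}wz -cmodM.
  set A := P m w - P m z in h1 h3; set B := P n w - P n z in h2 h4.
  set G := F w - F z in h3 h4.
  have -> : (l n - l m) * (w - z) =
    (A - l m * (w - z)) - (B - l n * (w - z)) + ((G - A) - (G - B)) by ring.
  apply: (le_trans (cmodD _ _)).
  have := cmodD (A - l m * (w - z)) (- (B - l n * (w - z))).
  have := cmodD (G - A) (- (G - B)).
  by rewrite !cmodN; move: h1 h2 h3 h4 h5; rewrite wz; lra.
have [L LP] := cplane_cauchy_lim lC.
apply/cplane_derivableP; exists L => e e0.
(* The errors add up to [e / 2 + b m + 8 * b m], below [e] when [b m < e / 20]. *)
have [m bme] := b_small _ (divr_gt0 e0 (ltr0Sn R 19)).
have [d d0 dP'] := lP m _ (divr_gt0 e0 (ltr0Sn R 1)).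
exists (Num.min d r); first by rewrite lt_min d0.
move=> w; rewrite lt_min => /andP[/dP' h1 /(FP m) h2].
have -> : F w - F z - L * (w - z) = (P m w - P m z - l m * (w - z)) +
  ((F w - F z) - (P m w - P m z)) + (- ((L - l m) * (w - z))) by ring.
apply: (le_trans (cmodD _ _)); rewrite cmodN.
have h3 : cmod ((L - l m) * (w - z)) <= 8 * b m * cmod (w - z).
  rewrite cmodM ler_wpM2r ?cmod_ge0//; apply: (le_trans (LP m)); lra.
have := cmodD (P m w - P m z - l m * (w - z)) ((F w - F z) - (P m w - P m z)).
have := ler_wpM2r (cmod_ge0 (w - z)) (ltW bme).
have := mulr_ge0 (ltW e0) (cmod_ge0 (w - z)); lra.
Qed.

(* The peak function is [sum_n (s ^ n - s ^ n.+1) g_n] with [1 - s = k] and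
   [M * k] small. Each [g_n] is small outside a disc on which the previous
   partial sums are almost constant, so at any point other than [c] at most one
   term is large, and its weight is too small to bring the sum up to 1. *)
Lemma peak_function K c (M : R) : 0 <= M -> K c -> ~ interior K c ->
  (forall rho : R, 0 < rho -> exists g : C -> C, bump K c M rho g) ->
  exists F : C -> C, [/\ uniform_algebra K F, F c = 1 &
    forall w, K w -> w != c -> cmod (F w) < 1].
Proof.
move=> M0 Kc nKc bumps.
have /choice[G GP] : forall rho : R, exists g : C -> C,
      0 < rho -> bump K c M rho g.
  move=> rho; have [/bumps[g gP]|n0] := pselect (0 < rho); first by exists g.
  by exists (fun=> 0).
(* A modulus of continuity at [c], made total for use in the recursion; it is unconstrained where
   its premises fail. *)
have /choice[mod modP] : forall Fe : (C -> C) * R, exists d : R,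
    {within K, continuous Fe.1} -> 0 < Fe.2 -> 0 < d /\
      forall w, K w -> cmod (w - c) < d -> cmod (Fe.1 w - Fe.1 c) < Fe.2.
  move=> [f e] /=; have [[cf e0]|n] := pselect ({within K, continuous f} /\ 0 < e).
    have [d d0 dP] := (cplane_continuousP K f).1 cf c Kc e e0.
    by exists d.
  by exists 0 => cf e0; exfalso; apply: n.
(* In the final estimate the losses [2 * a n] and [a n * M] then total at most
   [3 / 100 * s ^+ n]. *)
have [k [k0 k100 Mk]] : exists k : R, [/\ 0 < k, k <= 1 / 100 & M * k <= 1 / 100].
  have M1 : 0 < 100 * (M + 1) by lra.
  exists (100 * (M + 1))^-1; rewrite invr_gt0; split => //.
    by rewrite div1r lef_pV2 ?posrE//; lra.
  by rewrite ler_pdivrMr//; lra.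
have [s sE] : exists s : R, s = 1 - k by eexists.
pose a n : R := k * s ^+ n.
have s01 : 0 <= s < 1 by lra.
have s0 : 0 < s by lra.
have sn0 n : 0 < s ^+ n by rewrite exprn_gt0.
have a0 n : 0 < a n by rewrite mulr_gt0.
have sS n : s ^+ n.+1 = s ^+ n - a n by rewrite exprS /a sE; ring.
(* Both sequences are built together: [rho n] selects the next summand, and the new partial sum
   decides how small [rho n.+1] must be. *)
have [P [rho [P0 rho_0 PS rhoS]]] : exists (P : nat -> C -> C) (rho : nat -> R),
    [/\ P 0%N = (fun=> 0), rho 0%N = 1 / 4,
      forall n, P n.+1 = (fun w => P n w + ((a n)%:C%C : C) * G (rho n) w) &
      forall n, rho n.+1 = Num.min (rho n / 2) (mod (P n.+1, a n))].
  pose st := fix st n : (C -> C) * R := if n is m.+1 then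
    let P : C -> C := fun w => (st m).1 w + ((a m)%:C%C : C) * G (st m).2 w in
    (P, Num.min ((st m).2 / 2) (mod (P, a m)))
  else (fun=> 0, 1 / 4).
  by exists (fun n => (st n).1), (fun n => (st n).2).
pose g n := G (rho n).
have PSw n w : P n.+1 w = P n w + ((a n)%:C%C : C) * g n w by rewrite PS.
have inv n : 0 < rho n /\ {within K, continuous (P n)}.
  elim: n => [|n [rn cP]].
    by rewrite P0 rho_0; split; [lra|exact: cst_continuous].
  have [cg _ _ _ _] := GP _ rn.
  have cPS : {within K, continuous (P n.+1)}.
    by rewrite PS; exact: within_continuous_axpy.
  split => //; rewrite rhoS lt_min divr_gt0//=.
  by have [] := modP (P n.+1, a n) cPS (a0 n).
have rho0 n : 0 < rho n by case: (inv n).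
have cP n : {within K, continuous (P n)} by case: (inv n).
have rho_mono m n : (m <= n)%N -> rho n <= rho m.
  elim: n => [|n IH]; first by rewrite leqn0 => /eqP ->.
  rewrite leq_eqVlt => /predU1P[-> //|]; rewrite ltnS => /IH.
  apply: le_trans; rewrite rhoS ge_min; apply/orP; left.
  by have := rho0 n; lra.
have rho14 n : rho n <= 1 / 4 by rewrite -rho_0 rho_mono.
have rho_small (e : R) : 0 < e -> exists n, rho n <= e.
  move=> e0; have [n nP] : exists n, (1 / 2 : R) ^+ n < e.
    by apply: expr_small => //; lra.
  exists n; apply: le_trans (ltW nP).
  elim: n {nP} => [|n IH]; first by rewrite expr0 (le_trans (rho14 _))//; lra.
  by rewrite rhoS ge_min exprS; apply/orP; left; lra.
have gP n := GP _ (rho0 n).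
have Pc n : P n c = (1 - s ^+ n)%:C%C.
  elim: n => [|n IH]; first by rewrite P0 expr0 subrr.
  have [_ _ gc _ _] := gP n.
  by rewrite PSw IH [g n c]gc mulr1 -rmorphD sS; congr (_%:C%C); ring.
have near_c n w : K w -> cmod (w - c) < rho n ->
    cmod (P n w) <= 1 - s ^+ n + 2 * a n.
  case: n => [|n] Kw wc; first by rewrite P0 cmod0 expr0; have := a0 0%N; lra.
  move: wc; rewrite rhoS lt_min => /andP[_ wc].
  have [_ /(_ w Kw wc) /=] := modP (P n.+1, a n) (cP _) (a0 n).
  have := cmod_le_add (P n.+1 w) (P n.+1 c); rewrite [in cmod (P n.+1 c)]Pc.
  rewrite cmodR ger0_norm; last first.
    by rewrite subr_ge0 exprn_ile1//; lra.
  (* Consecutive weights have ratio [s], which exceeds [1 / 2]. *)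
  have : a n <= 2 * a n.+1.
    have k2 : 0 <= 1 - 2 * k by lra.
    by rewrite /a sS /a; have := mulr_ge0 (mulr_ge0 (ltW k0) (ltW (sn0 n))) k2; lra.
  lra.
have tail B m n w : (m <= n)%N ->
    (forall j, (m <= j)%N -> cmod (g j w) <= B) ->
    cmod (P n w - P m w) <= B * (s ^+ m - s ^+ n).
  move=> mn gM; elim: n mn => [|n IH].
    by rewrite leqn0 => /eqP ->; rewrite !subrr cmod0 mulr0.
  rewrite leq_eqVlt => /predU1P[->|]; first by rewrite !subrr cmod0 mulr0.
  rewrite ltnS => mn; have := IH mn; have := gM n mn.
  rewrite PSw addrAC => h1 h2; apply: (le_trans (cmodD _ _)).
  rewrite cmodM cmodR gtr0_norm// sS.
  by have := ler_wpM2l (ltW (a0 n)) h1; lra.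
(* The factor 2 is that of [cplane_cauchy_lim]; off [K] the values of [F] are unconstrained. *)
have /choice[F FP] : forall w, exists l : C, K w ->
    forall m, cmod (l - P m w) <= 2 * (M * s ^+ m).
  move=> w; have [Kw|nKw] := pselect (K w); last by exists 0.
  have [|l lP] := @cplane_cauchy_lim R (P^~ w) (fun m => M * s ^+ m).
    move=> m n mn; apply: (le_trans (@tail M m n w mn _)).
      by move=> j _; have [_ _ _ gM _] := gP j; exact: gM.
    by have := mulr_ge0 M0 (ltW (sn0 n)); lra.
  by exists l.
have s_mono m n : (m <= n)%N -> s ^+ n <= s ^+ m.
  by move=> mn; apply: ler_wiXn2l; lra || exact: mn.
have FP_small (e : R) : 0 < e -> exists N, forall n w, (N <= n)%N -> K w ->
    cmod (F w - P n w) < e.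
  move=> e0; have M1 : 0 < 2 * M + 1 by lra.
  have [N] := expr_small s01 (divr_gt0 e0 M1).
  rewrite ltr_pdivlMr// => NP; exists N => n w Nn Kw.
  apply: (le_lt_trans (FP w Kw n)).
  have := ler_wpM2l M0 (s_mono _ _ Nn); have := sn0 N; lra.
have F_le w (B : R) m : K w -> (forall n, (m <= n)%N -> cmod (P n w) <= B) ->
    cmod (F w) <= B.
  move=> Kw PB; apply/ler_addgt0Pr => e e0; have [N NP] := FP_small e e0.
  have := NP (maxn N m) w (leq_maxl _ _) Kw.
  have := PB (maxn N m) (leq_maxr _ _).
  have := cmod_le_add (F w) (P (maxn N m) w); lra.
have cF : {within K, continuous F}.
  apply/cplane_continuousP => z Kz e e0.
  have e3 : 0 < e / 3 by rewrite divr_gt0.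
  have [N NP] := FP_small _ e3.
  have [d d0 dP] := (cplane_continuousP K (P N)).1 (cP N) z Kz _ e3.
  exists d => // w Kw wz; have h1 := NP N w (leqnn _) Kw.
  have h2 := NP N z (leqnn _) Kz; have h3 := dP w Kw wz.
  apply: (le_lt_trans (cmod_dist _ (P N w) _)).
  have := cmod_dist (P N w) (P N z) (F z); rewrite (cmodBC (P N z)); lra.
have tail_diff J m n w z : K w -> K z -> rho J <= cmod (w - c) ->
    rho J <= cmod (z - c) -> (J <= m)%N -> (m <= n)%N ->
    cmod ((P n w - P n z) - (P m w - P m z)) <= (s ^+ m - s ^+ n) * cmod (w - z).
  move=> Kw Kz wJ zJ Jm mn; elim: n mn => [|n IH].
    by rewrite leqn0 => /eqP ->; rewrite !subrr cmod0 mul0r.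
  rewrite leq_eqVlt => /predU1P[->|]; first by rewrite !subrr cmod0 mul0r.
  rewrite ltnS => mn; have := IH mn; rewrite !PSw sS => h1.
  have [_ _ _ _ gP2] := gP n.
  have Jn : rho n <= rho J by apply: rho_mono; exact: leq_trans mn.
  have h2 := (gP2 w Kw (le_trans Jn wJ)).2 z Kz (le_trans Jn zJ).
  have -> : P n w + (a n)%:C%C * g n w - (P n z + (a n)%:C%C * g n z) -
      (P m w - P m z) = (P n w - P n z - (P m w - P m z)) +
      (a n)%:C%C * (g n w - g n z) by ring.
  apply: (le_trans (cmodD _ _)); rewrite cmodM cmodR gtr0_norm//.
  by have := ler_wpM2l (ltW (a0 n)) h2; lra.
have dP n z : interior K z -> derivable (P n) z 1.
  move=> iz; elim: n => [|n IH]; first by rewrite P0; exact: derivable_cst.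
  have [_ dg _ _ _] := gP n; rewrite PS.
  by apply: derivable_axpy; [exact: IH|exact: dg].
exists F; split.
- split=> [|z iz]; first exact: cF.
  have Kz : K z by exact: interior_subset.
  have zc : 0 < cmod (z - c).
    by rewrite cmod_gt0 subr_eq0; apply/eqP => zc; apply: nKc; rewrite -zc.
  have zc2 : 0 < cmod (z - c) / 2 by rewrite divr_gt0.
  (* Within [cmod (z - c) / 2] of [z], all summands from [J] on are 1-Lipschitz on [K], so tails of
     difference quotients are at most [s ^+ (J + m)]. *)
  have [J JP] := rho_small _ zc2.
  have /cplane_interiorP [r r0 rP] := iz.
  apply: (@derivable_lim (fun m => P (J + m)%N) F z
    (Num.min r (cmod (z - c) / 2)) (fun m => s ^+ (J + m))).
  + by rewrite lt_min r0.
  + by move=> m n mn; apply: s_mono; rewrite leq_add2l.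
  + move=> e e0; have [n nP] := expr_small s01 e0; exists n.
    by apply: le_lt_trans nP; apply: s_mono; rewrite leq_addl.
  + by move=> m; exact: sn0.
  + by move=> m; exact: dP.
  move=> m w; rewrite lt_min => /andP[wr wz]; have Kw := rP w wr.
  have wJ : rho J <= cmod (w - c).
    by have := cmod_dist z w c; rewrite (cmodBC z w); lra.
  have zJ : rho J <= cmod (z - c) by lra.
  apply/ler_addgt0Pr => e e0.
  have e2 : 0 < e / 2 by rewrite divr_gt0.
  have [N NP] := FP_small _ e2; pose n := maxn N (J + m).
  have h1 := NP n w (leq_maxl _ _) Kw; have h2 := NP n z (leq_maxl _ _) Kz.
  have h3 := tail_diff J (J + m)%N n w z Kw Kz wJ zJ (leq_addr _ _) (leq_maxr _ _).
  have -> : F w - F z - (P (J + m)%N w - P (J + m)%N z) =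
    (P n w - P n z - (P (J + m)%N w - P (J + m)%N z)) +
    ((F w - P n w) - (F z - P n z)) by ring.
  apply: (le_trans (cmodD _ _)).
  have := cmodD (F w - P n w) (- (F z - P n z)); rewrite cmodN.
  have := mulr_ge0 (ltW (sn0 n)) (cmod_ge0 (w - z)); lra.
- apply/eqP; rewrite -subr_eq0 -cmod_eq0 eq_le cmod_ge0 andbT.
  apply/ler_addgt0Pr => e e0; rewrite add0r.
  have e2 : 0 < e / 2 by rewrite divr_gt0.
  have [N NP] := FP_small _ e2; have [m mP] := expr_small s01 e2.
  have h1 := NP (maxn N m) c (leq_maxl _ _) Kc.
  have h2 := s_mono _ _ (leq_maxr N m).
  have h3 := cmod_dist (F c) (P (maxn N m) c) 1.
  have h4 : cmod (P (maxn N m) c - 1) = s ^+ maxn N m.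
    by rewrite Pc rmorphB rmorph1 addrAC subrr add0r cmodN cmodR gtr0_norm.
  by move: h3; rewrite h4; lra.
move=> w Kw wc.
have wc0 : 0 < cmod (w - c) by rewrite cmod_gt0 subr_eq0.
have ex : exists n, rho n <= cmod (w - c) by exact: rho_small.
(* From the first [n] with [w] outside the disc of radius [rho n], the summands are small. The one
   before is bounded by [M], and the partial sum preceding it is close to its value at [c]. *)
case: (ex_minnP ex) => n nw n_min.
have g14 j : (n <= j)%N -> cmod (g j w) <= 1 / 4.
  move=> nj; have [_ _ _ _ gP2] := gP j; apply: le_trans (rho14 j).
  by apply: (gP2 w Kw _).1; apply: le_trans nw; exact: rho_mono.
case: n nw n_min g14 => [|n] nw n_min g14.
  apply: (@le_lt_trans _ _ (1 / 4)); last by lra.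
  apply: (F_le w _ 0%N Kw) => m _; have := tail _ 0%N m w (leq0n m) g14.
  by rewrite P0 subr0 expr0; have := sn0 m; lra.
have wn : cmod (w - c) < rho n.
  by rewrite ltNge; apply/negP => /n_min; rewrite ltnn.
have h1 := near_c n w Kw wn.
have h2 : cmod (P n.+1 w) <= 1 - s ^+ n + 2 * a n + a n * M.
  rewrite PSw; apply: (le_trans (cmodD _ _)); rewrite cmodM cmodR gtr0_norm//.
  have [_ _ _ gM _] := gP n; have := ler_wpM2l (ltW (a0 n)) (gM w Kw).
  lra.
(* The sum is at most [1 - s ^+ n + 3 / 100 * s ^+ n + 1 / 4 * s ^+ n.+1]. *)
apply: (@le_lt_trans _ _ (1 - s ^+ n / 2)); last by have := sn0 n; lra.
apply: (F_le w _ n.+1 Kw) => m nm.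
have h3 := tail _ n.+1 m w nm g14.
have h4 := cmod_le_add (P m w) (P n.+1 w).
have h5 := ler_wpM2r (ltW (sn0 n)) k100.
have h6 := ler_wpM2r (ltW (sn0 n)) Mk.
have h7 := sn0 m; have h8 := a0 n.
by move: h2 h3; rewrite sS /a in h8 *; lra.
Qed.

End Peak.

(** * The sup norm of a peak function and the two inclusions *)

Lemma cmod_lt1 (R : realType) (x : R[i]) : (`|x| < 1) = (cmod x < 1).
Proof. by rewrite cmodE -(ltcR (cmod x) 1). Qed.

Lemma sup_norm_peak (R : realType) (K : set (Cplane R)) (f : Cplane R -> Cplane R)
    (c : Cplane R) :
  K c -> f c = 1 -> (forall w, K w -> cmod (f w) <= 1) -> sup_norm K f = 1.
Proof.
move=> Kc fc f1; apply/eqP; rewrite eq_le; apply/andP; split.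
  by apply: ge_sup => [|_ [w Kw <-]]; [exists (cmod (f c)), c|exact: f1].
apply: ub_le_sup; first by exists 1 => _ [w Kw <-]; exact: f1.
by exists c; rewrite // fc -[LHS]/(cmod 1) cmod1.
Qed.

Theorem theorem11p2 (R : realType) (K : set (Cplane R))
  (cptK : compact K) (connCK : connected (~` K)) :
  strong_boundary K = boundary K.
Proof.
have clK := cplane_compact_closed cptK.
apply/seteqP; split=> [c [Kc peaks]|c [clc nKc]].
  split; first exact: subset_closure.
  move=> /cplane_interiorP [e e0 eK].
  have e2 : 0 < e / 2 < e by lra.
  (* The circle of radius [e / 2] lies in [K] but outside this open disc, so the peak function has
     modulus below 1 on it. *)
  have Uc : [set w : Cplane R | cmod (w - c) < e / 2] c.
    by rewrite /= subrr cmod0; lra.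
  have [f [[_ df] _ fc f1]] := peaks _ (@cplane_open_ball R c (e / 2)) Uc.
  apply: (no_interior_peak e2 _ _ fc).
    move=> z zc; apply: df; apply/cplane_interiorP.
    exists (e - cmod (z - c)); first by rewrite subr_gt0.
    by move=> w wz; apply: eK; have := cmod_dist w z c; lra.
  move=> z zc; rewrite -cmod_lt1; apply: f1; split.
    by apply: eK; rewrite zc; lra.
  by rewrite /= zc ltxx.
have Kc : K c by exact: clK.
split=> // U oU Uc.
have [F [AF Fc F1]] := peak_function (ler0n R 400) Kc nKc
  (fun rho => approximate_peak cptK connCK Kc nKc).
exists F; split=> //.
  apply: (sup_norm_peak Kc Fc) => w Kw.
  by have [->|/(F1 w Kw)/ltW//] := eqVneq w c; rewrite Fc cmod1.
move=> w [Kw nUw]; rewrite cmod_lt1; apply: F1 => //.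
by apply/eqP => wc; apply: nUw; rewrite wc.
Qed.
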